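(* Let $T\ge1$ be an integer, let $f:\mathbb{R}^d\to\mathbb{R}$ be $L$-smooth, and suppose that Assumptions 1, 2 and 4 hold (bounded below, unbiased gradient oracle, relaxed affine variance in expectation, with constants $A,B,C>0$). Put $\overline{\Delta}_1=f(x_1)-f^*$ and $\overline{\Delta}_e=4\overline{\Delta}_1+8$. Let $\{\overline{x}_t\}_{t\in[T]}$ be generated by SGD or by RSAG with the constant step size $$\theta_t=\eta=\min\left\{\frac{1}{\sqrt{3LAT}},\sqrt{\frac{2}{3LCT}},\sqrt{\frac{2}{5L\left(A\overline{\Delta}_e+2L(B+1)\overline{\Delta}_e+C\right)}},\frac{1}{4L(B+1)}\right\}.$$ Then $$\begin{aligned}\mathbb{E}\left[\frac1T\sum_{t=1}^T\|\nabla f(\overline{x}_t)\|^2\right]\le{}&\frac{2\overline{\Delta}_1}{\sqrt T}\left(\sqrt{3LA}+\sqrt{\frac{3LC}{2}}\right)+\frac{4}{\sqrt{3T}}\left(\overline{\Delta}_e\sqrt{LA}+\sqrt{2LC}\right)\\&+\frac{2\overline{\Delta}_1}{T}\left(\sqrt{\frac{5L\left(A\overline{\Delta}_e+2L(B+1)\overline{\Delta}_e+C\right)}{2}}+4L(B+1)\right).\end{aligned}$$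
   Context: Notation: $\|\cdot\|$ is the Euclidean norm on $\mathbb{R}^d$, $[T]=\{1,\dots,T\}$. The objective is $f(x)=\mathbb{E}_{z\sim\mathcal D}[f_z(x;z)]$, differentiable, with stochastic gradient oracle $\nabla f_z(x;z)$; $z_1,\dots,z_T$ are independent samples from $\mathcal D$. $L$-smoothness ($L>0$): $\|\nabla f(x)-\nabla f(y)\|\le L\|x-y\|$ for all $x,y\in\mathbb{R}^d$. Assumption 1: $f^*:=\inf_{x}f(x)>-\infty$. Assumption 2: $\mathbb{E}_z[\nabla f_z(x;z)]=\nabla f(x)$ for all $x$. Assumption 4: for constants $A,B,C>0$, for all $x$, $\mathbb{E}_z\left[\|\nabla f_z(x;z)-\nabla f(x)\|^2\right]\le A(f(x)-f^* )+B\|\nabla f(x)\|^2+C$. Generic AGD template: given (deterministic) $\tilde x_1=x_1\in\mathbb{R}^d$, $\alpha_t\in(0,1]$ and step sizes $\theta_t,\gamma_t$, for $t=1,\dots,T$: $\overline{x}_t=\alpha_tx_t+(1-\alpha_t)\tilde x_t$; $g_t=\nabla f_z(\overline{x}_t;z_t)$; $x_{t+1}=x_t-\theta_tg_t$; $\tilde x_{t+1}=\overline{x}_t-\gamma_tg_t$. RSAG with constant step size: $\theta_t=\eta$ constant, $\alpha_t=\frac{2}{t+1}$, $\gamma_t=(1+\alpha_t)\theta_t$. SGD: $\theta_t=\gamma_t=\eta$ constant (so $\overline{x}_t=x_t$). *)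

(* Defs.v *)
From HB Require Import structures.
From mathcomp Require Import all_boot all_order all_algebra.
From mathcomp Require Import all_classical all_reals all_analysis.
Set Implicit Arguments.
Unset Strict Implicit.
Unset Printing Implicit Defensive.
Import Order.TTheory GRing.Theory Num.Theory.
Import numFieldNormedType.Exports.
Local Open Scope classical_set_scope.
Local Open Scope ring_scope.

(* The library norm on ['rV[R]_d] is the sup norm, which induces the same
   topology, hence the same notions of differentiability and Borel set; the
   Euclidean norm has to be introduced separately. *)
Definition enorm (R : realType) (d : nat) (x : 'rV[R]_d) : R :=
  Num.sqrt (\sum_(i < d) x ord0 i ^+ 2).

(* Row vector of partial derivatives.  As ['D_v f x] is total, this is the
   gradient only where [f] is differentiable. *)
Definition gradient (R : realType) (d : nat) (f : 'rV[R]_d -> R)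
    (x : 'rV[R]_d) : 'rV[R]_d :=
  \row_(i < d) 'D_(delta_mx ord0 i) f x.

Definition smooth (R : realType) (d : nat) (L : R) (f : 'rV[R]_d -> R) : Prop :=
  (forall x, differentiable f x) /\
  (forall x y, enorm (gradient f x - gradient f y) <= L * enorm (x - y)).

Definition inf_value (R : realType) (d : nat) (f : 'rV[R]_d -> R) : R :=
  inf (range f).

Definition bounded_below (R : realType) (d : nat) (f : 'rV[R]_d -> R) : Prop :=
  has_lbound (range f).

Definition is_expected_objective (R : realType) (dZ : measure_display)
    (Z : measurableType dZ) (D : probability Z R) (d : nat)
    (fz : 'rV[R]_d -> Z -> R) (f : 'rV[R]_d -> R) : Prop :=
  forall x, D.-integrable [set: Z] (fun z => (fz x z)%:E) /\
            ('E_D[fz x] = (f x)%:E)%E.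

(* The sample-wise objective [fz x z] is not assumed to be differentiable in
   [x]; where it is not, the oracle may return anything, as long as it stays
   jointly measurable, for the Borel sigma-algebra of R^d on the [x] side. *)
Definition is_gradient_oracle (R : realType) (dZ : measure_display)
    (Z : measurableType dZ) (d : nat)
    (fz : 'rV[R]_d -> Z -> R) (g : 'rV[R]_d -> Z -> 'rV[R]_d) : Prop :=
  (forall x z, differentiable (fz ^~ z) x -> g x z = gradient (fz ^~ z) x) /\
  (forall i : 'I_d, measurable_fun
     [set: (g_sigma_algebraType (@open 'rV[R]_d) * Z)%type]
     (fun p : (g_sigma_algebraType (@open 'rV[R]_d) * Z)%type =>
        g p.1 p.2 ord0 i)).

(* The vector-valued expectation is taken coordinatewise. *)
Definition unbiased (R : realType) (dZ : measure_display)
    (Z : measurableType dZ) (D : probability Z R) (d : nat)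
    (g : 'rV[R]_d -> Z -> 'rV[R]_d) (f : 'rV[R]_d -> R) : Prop :=
  forall (x : 'rV[R]_d) (i : 'I_d),
    D.-integrable [set: Z] (fun z => (g x z ord0 i)%:E) /\
    ('E_D[fun z => g x z ord0 i] = (gradient f x ord0 i)%:E)%E.

(* The left-hand side is an extended real: finiteness of the variance is part
   of the property. *)
Definition relaxed_affine_variance (R : realType) (dZ : measure_display)
    (Z : measurableType dZ) (D : probability Z R) (d : nat) (A B C : R)
    (g : 'rV[R]_d -> Z -> 'rV[R]_d) (f : 'rV[R]_d -> R) : Prop :=
  forall x : 'rV[R]_d,
    ('E_D[(fun z => enorm (g x z - gradient f x) ^+ 2)%R] <=
     (A * (f x - inf_value f) + B * enorm (gradient f x) ^+ 2 + C)%R%:E)%E.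

(* [z 1, ..., z T] are mutually independent with common law [D]; the values of
   [z] outside [1, T] are irrelevant. *)
Definition iid_samples (R : realType) (dO dZ : measure_display)
    (Omega : measurableType dO) (Z : measurableType dZ)
    (P : probability Omega R) (D : probability Z R) (T : nat)
    (z : nat -> {RV P >-> Z}) : Prop :=
  (forall t, (1 <= t <= T)%N ->
     forall E : set Z, measurable E -> distribution P (z t) E = D E) /\
  (forall J : seq nat, uniq J -> (forall t, t \in J -> (1 <= t <= T)%N) ->
     forall E : nat -> set Z, (forall t, measurable (E t)) ->
     P (\bigcap_(t in [set` J]) (z t @^-1` E t)) =
     (\prod_(t <- J) P (z t @^-1` E t))%E).

(* One run of the method on a realized sample path [z]; [x], [xt], [xb] stand
   for x, x-tilde and x-bar, indexed from 1. *)
Definition agd_run (R : realType) (Z : Type) (d : nat) (T : nat)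
    (x1 : 'rV[R]_d) (alpha theta gamma : nat -> R)
    (g : 'rV[R]_d -> Z -> 'rV[R]_d) (z : nat -> Z)
    (x xt xb : nat -> 'rV[R]_d) : Prop :=
  [/\ x 1%N = x1, xt 1%N = x1
    & forall t, (1 <= t <= T)%N ->
      [/\ xb t = alpha t *: x t + (1 - alpha t) *: xt t,
          x t.+1 = x t - theta t *: g (xb t) (z t)
        & xt t.+1 = xb t - gamma t *: g (xb t) (z t)]].

(* The weights [alpha] play no role for SGD, since then x-tilde = x = x-bar. *)
Definition sgd_parameters (R : realType) (T : nat) (eta : R)
    (alpha theta gamma : nat -> R) : Prop :=
  forall t, (1 <= t <= T)%N ->
    [/\ 0 < alpha t <= 1, theta t = eta & gamma t = eta].

Definition rsag_parameters (R : realType) (T : nat) (eta : R)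
    (alpha theta gamma : nat -> R) : Prop :=
  forall t, (1 <= t <= T)%N ->
    [/\ alpha t = 2 / (t%:R + 1), theta t = eta
      & gamma t = (1 + alpha t) * theta t].

(* Main.v *)
(* Write gap := f - inf f, x = x_t, y = xbar_t, u_t = x_t - xtilde_t.  Testing
   the descent lemma on the sequence x_t, rather than on xtilde_t, and using
   that the sample z_t is independent of (x_t, xtilde_t), one gets
     E gap(x_(t+1)) <= E gap(x) - (3/4) eta E|grad f(y)|^2
                       + eta L^2 E|x - y|^2 + (L eta^2 / 2) E|g_t|^2.
   The drift |x - y|^2 is controlled pathwise by the potential t |u_t|^2, which
   gives sum_t |x_t - xbar_t|^2 <= 2 eta^2 sum_t |g_t|^2 (for SGD, u_t = 0),
   while gap(y) <= 2 gap(x) + L |x - y|^2 turns the affine variance bound at y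
   into one at x.  The step size makes all error terms absorbable: first
   E gap(x_t) stays bounded by a fixed multiple of gap(x_1) + 20/27, hence the
   average of E gap(xbar_t) is at most 2 Deltae, and then the telescoped
   inequality yields the rate. *)
Require Import Defs.
From HB Require Import structures.
From mathcomp Require Import all_boot all_order all_algebra.
From mathcomp Require Import all_classical all_reals all_analysis.
From mathcomp Require Import measurable_realfun ring lra.
Import Order.TTheory GRing.Theory Num.Theory.
Import numFieldNormedType.Exports.
Local Open Scope classical_set_scope.
Local Open Scope ring_scope.

(** * Euclidean geometry and smooth functions *)

Definition dot {R : realType} {d : nat} (u v : 'rV[R]_d) : R :=
  \sum_(i < d) u ord0 i * v ord0 i.

Definition sqn {R : realType} {d : nat} (u : 'rV[R]_d) : R := dot u u.

Section dot_theory.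
Context {R : realType} {d : nat}.
Implicit Types u v w : 'rV[R]_d.

Lemma dotC u v : dot u v = dot v u.
Proof. by apply: eq_bigr => i _; rewrite mulrC. Qed.

Lemma dotDl u v w : dot (u + v) w = dot u w + dot v w.
Proof. by rewrite -big_split; apply: eq_bigr => i _; rewrite mxE mulrDl. Qed.

Lemma dotZl c u w : dot (c *: u) w = c * dot u w.
Proof. by rewrite mulr_sumr; apply: eq_bigr => i _; rewrite mxE mulrA. Qed.

Lemma dotNl u w : dot (- u) w = - dot u w.
Proof. by rewrite -scaleN1r dotZl mulN1r. Qed.

Lemma dotDr u v w : dot w (u + v) = dot w u + dot w v.
Proof. by rewrite dotC dotDl !(dotC w). Qed.

Lemma dotZr c u w : dot w (c *: u) = c * dot w u.
Proof. by rewrite dotC dotZl dotC. Qed.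

Lemma dotNr u w : dot w (- u) = - dot w u.
Proof. by rewrite dotC dotNl dotC. Qed.

Definition dotE := (dotDl, dotDr, dotNl, dotNr, dotZl, dotZr).

Lemma sqn_ge0 u : 0 <= sqn u.
Proof. by apply: sumr_ge0 => i _; rewrite -expr2 sqr_ge0. Qed.

Lemma sqn0 : sqn (0 : 'rV[R]_d) = 0.
Proof. by rewrite /sqn -(scale0r 0) dotZl mul0r. Qed.

Lemma sqnZ c u : sqn (c *: u) = c ^+ 2 * sqn u.
Proof. by rewrite /sqn dotZl dotZr mulrA. Qed.

Lemma sqnC u v : sqn (u - v) = sqn (v - u).
Proof. by rewrite -opprB -scaleN1r sqnZ sqrrN expr1n mul1r. Qed.

Lemma enorm_ge0 u : 0 <= enorm u. Proof. exact: sqrtr_ge0. Qed.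

Lemma enorm_sq u : enorm u ^+ 2 = sqn u.
Proof.
by rewrite sqr_sqrtr ?sumr_ge0// => i _; exact: sqr_ge0.
Qed.

Lemma young c u v : 0 < c -> dot u v <= c / 2 * sqn u + (2 * c)^-1 * sqn v.
Proof.
move=> c0; have := sqn_ge0 (c *: u - v).
rewrite /sqn !dotE (dotC v u) => h.
rewrite -(ler_pM2l (_ : 0 < 2 * c)); last by lra.
have -> : 2 * c * (c / 2 * dot u u + (2 * c)^-1 * dot v v) =
  c ^+ 2 * dot u u + dot v v by field; lra.
by nra.
Qed.

Lemma sqn_convex a u v : 0 <= a <= 1 ->
  sqn ((1 - a) *: u + a *: v) <= (1 - a) * sqn u + a * sqn v.
Proof.
move=> /andP[a0 a1]; have := sqn_ge0 (u - v).
rewrite /sqn !dotE (dotC v u) => h.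
have : 0 <= a * (1 - a) * (dot u u - dot u v - (dot u v - dot v v)).
  by rewrite mulr_ge0 ?mulr_ge0//; lra.
by nra.
Qed.

Lemma ler_coord_sqn u i : u ord0 i ^+ 2 <= sqn u.
Proof.
rewrite /sqn /dot (bigD1 i)//= -expr2 lerDl.
by apply: sumr_ge0 => j _; rewrite -expr2 sqr_ge0.
Qed.

End dot_theory.

(** * Consequences of smoothness and of boundedness from below *)

Section descent.
Context {R : realType} {d : nat} {L : R} {f : 'rV[R]_d -> R}.
Hypotheses (L_gt0 : 0 < L) (f_smooth : smooth L f).

Lemma smooth_sqn x y :
  sqn (gradient f x - gradient f y) <= L ^+ 2 * sqn (x - y).
Proof.
rewrite -!enorm_sq -exprMn lerXn2r ?nnegrE ?enorm_ge0//.
  by rewrite mulr_ge0 ?enorm_ge0// ltW.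
exact: f_smooth.2.
Qed.

Lemma derive_gradient x v : 'D_v f x = dot (gradient f x) v.
Proof.
have df := f_smooth.1 x.
rewrite deriveE// [v in LHS]row_sum_delta linear_sum/=.
by apply: eq_bigr => i _; rewrite linearZ/= -deriveE// mxE mulrC.
Qed.

Lemma is_derive_line x v (s : R) :
  is_derive s 1 (fun s => f (x + s *: v)) (dot (gradient f (x + s *: v)) v).
Proof.
have dv : derivable f (x + s *: v) v.
  by apply: diff_derivable; exact: f_smooth.1.
rewrite -derive_gradient.
have E : (fun h : R => h^-1 *: (((fun s => f (x + s *: v)) \o shift s) (h *: 1)
      - f (x + s *: v))) =
    (fun h : R =>
      h^-1 *: ((f \o shift (x + s *: v)) (h *: v) - f (x + s *: v))).
  apply/funext => h /=.
  have -> : h *: (1 : R) = h by rewrite /GRing.scale/= mulr1.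
  by rewrite scalerDl addrCA.
by split; rewrite /derivable /derive E.
Qed.

(** Subtracting the linear and quadratic terms along the segment from [x] to [y] leaves a function
    [p] whose derivative is nonpositive on the open unit interval. *)
Lemma descent x y :
  f y <= f x + dot (gradient f x) (y - x) + L / 2 * sqn (y - x).
Proof.
set v := y - x.
pose p s := f (x + s *: v) - s * dot (gradient f x) v - L / 2 * sqn v * s ^+ 2.
have dp (s : R) : is_derive s 1 p
    (dot (gradient f (x + s *: v)) v - dot (gradient f x) v - L * sqn v * s).
  have := is_derive_line x v s => ?.
  apply: is_derive_eq.
  by rewrite /GRing.scale/=; field.
have : p 1 <= p 0.
  apply: (@ler0_derive1_le_cc _ p 0 1); rewrite ?in_itv/= ?lexx ?ler01//.
  - move=> s; rewrite in_itv/= => /andP[s0 s1].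
    rewrite derive1E; have [_ ->] := dp s.
    rewrite -mulrA -dotNl -dotDl.
    (* After the Lipschitz bound, this Young weight makes both halves equal to
       [L * s * sqn v / 2]. *)
    have Ls0 : 0 < (L * s)^-1 by rewrite invr_gt0 mulr_gt0.
    have := young _ (gradient f (x + s *: v) - gradient f x) v Ls0.
    have := smooth_sqn (x + s *: v) x.
    rewrite addrAC subrr add0r sqnZ => h1.
    move/le_trans => /(_ (L * (sqn v * s))); rewrite subr_le0; apply.
    apply: (@le_trans _ _ ((L * s)^-1 / 2 * (L ^+ 2 * (s ^+ 2 * sqn v)) +
      (2 * (L * s)^-1)^-1 * sqn v)).
      by rewrite lerD2r ler_wpM2l// divr_ge0// ltW.
    rewrite le_eqVlt; apply/orP; left; apply/eqP.
    by field; rewrite (gt_eqF L_gt0) (gt_eqF s0).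
  - apply: derivable_within_continuous => s _; by have [] := dp s.
rewrite /p scale1r scale0r addr0 mul0r mul1r expr1n expr0n/= mulr0 mulr1 !subr0.
have -> : x + v = y by rewrite addrC subrK.
by lra.
Qed.

Hypothesis f_bounded_below : bounded_below f.

Lemma inf_value_le x : inf_value f <= f x.
Proof. by apply: ge_inf => //; exists x. Qed.

(** A gradient step of length [L^-1] lowers [f] by at least [(2 * L)^-1 * sqn (gradient f x)] and
    cannot go below the infimum. *)
Lemma sqn_gradient_le x : sqn (gradient f x) <= 2 * L * (f x - inf_value f).
Proof.
have := descent x (x - L^-1 *: gradient f x).
have -> : x - L^-1 *: gradient f x - x = - (L^-1 *: gradient f x).
  by rewrite addrAC subrr add0r.
rewrite dotNr dotZr.
rewrite -scaleNr sqnZ sqrrN.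
have := inf_value_le (x + - L^-1 *: gradient f x).
rewrite -[dot _ _]/(sqn (gradient f x)) => h1 h2.
have h3 := le_trans h1 h2; rewrite -(ler_pM2l (_ : 0 < (2 * L)^-1)).
  rewrite mulrA mulVf ?mul1r ?gt_eqF//; last by rewrite mulr_gt0.
  suff : L / 2 * (L^-1 ^+ 2 * sqn (gradient f x)) =
      L^-1 * sqn (gradient f x) - (2 * L)^-1 * sqn (gradient f x) by lra.
  by field; rewrite gt_eqF.
by rewrite invr_gt0 mulr_gt0.
Qed.

(** Young with weight [L^-1] splits the cross term of the descent lemma: the gradient half costs one
    more gap at [x], the other half doubles the quadratic term. *)
Lemma gap_shift x y :
  f y - inf_value f <= 2 * (f x - inf_value f) + L * sqn (x - y).
Proof.
have := descent x y.
have Li : 0 < L^-1 by rewrite invr_gt0.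
have := young _ (gradient f x) (y - x) Li.
rewrite (sqnC x y).
have -> : (2 * L^-1)^-1 = L / 2 by field; rewrite gt_eqF.
have := sqn_gradient_le x.
rewrite -(ler_pM2l (_ : 0 < L^-1 / 2)); last by rewrite divr_gt0.
have -> : L^-1 / 2 * (2 * L * (f x - inf_value f)) = f x - inf_value f.
  by field; rewrite gt_eqF.
by lra.
Qed.

Lemma gap_step (eta : R) x g :
  f (x - eta *: g) - inf_value f <=
  f x - inf_value f - eta * dot (gradient f x) g + L / 2 * eta ^+ 2 * sqn g.
Proof.
have := descent x (x - eta *: g).
have -> : x - eta *: g - x = - eta *: g by rewrite addrAC subrr add0r scaleNr.
by rewrite dotZr sqnZ sqrrN mulrA; lra.
Qed.

(* The unbiased oracle produces the gradient at the query point [y], whereas the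
   descent lemma is applied at [x]. *)
Lemma dot_gradient_ge x y :
  3 / 4 * sqn (gradient f y) - L ^+ 2 * sqn (x - y) <=
  dot (gradient f x) (gradient f y).
Proof.
(* Young weight 2 charges the gradient difference with factor 1 and loses a quarter of
   [sqn (gradient f y)], whence 3/4. *)
have h : 0 < (2 : R) by [].
have := young _ (gradient f y - gradient f x) (gradient f y) h.
have := smooth_sqn y x.
rewrite (sqnC y x).
rewrite dotDl dotNl -[dot (gradient f y) _]/(sqn (gradient f y)).
have -> : ((2 * 2)^-1 : R) = 1 / 4 by field.
by lra.
Qed.

End descent.

(** * The scalar recursion *)

Section recursion.
(** In the application [a], [b], [e], [G], [q] are the expectations of the gap at x_t, the gap at
    xbar_t, the drift |x_t - xbar_t|^2, |grad f(xbar_t)|^2 and |g_t|^2. *)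
Context {R : realType} {T : nat} {a b e G q : nat -> R} {L A B C eta : R}.
Hypotheses (T_ge1 : (1 <= T)%N) (L_gt0 : 0 < L) (A_gt0 : 0 < A)
  (B_gt0 : 0 < B) (C_gt0 : 0 < C) (eta_gt0 : 0 < eta).
Hypothesis etaB : L * (B + 1) * eta <= 1 / 4.
Hypothesis etaAT : L * A * eta ^+ 2 * T%:R <= 1 / 3.
Hypothesis etaA : L * A * eta ^+ 2 <= 1 / 20.
Hypothesis etaCT : L * C * eta ^+ 2 * T%:R <= 2 / 3.
Hypotheses (a_ge0 : forall t, 0 <= a t) (b_ge0 : forall t, 0 <= b t)
  (G_ge0 : forall t, 0 <= G t)
  (q_ge0 : forall t, 0 <= q t).
Hypothesis a_step : forall t, (1 <= t <= T)%N ->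
  a t.+1 <= a t - 3 / 4 * eta * G t + eta * L ^+ 2 * e t +
    L / 2 * eta ^+ 2 * q t.
Hypothesis q_le : forall t, (1 <= t <= T)%N ->
  q t <= A * b t + (B + 1) * G t + C.
Hypothesis b_le : forall t, (1 <= t <= T)%N -> b t <= 2 * a t + L * e t.
Hypothesis e_sum : forall n, (n <= T)%N ->
  \sum_(1 <= t < n.+1) e t <= 2 * eta ^+ 2 * \sum_(1 <= t < n.+1) q t.

Let sum (h : nat -> R) n := \sum_(1 <= t < n.+1) h t.

Let sumS h n : sum h n.+1 = sum h n + h n.+1.
Proof. by rewrite /sum big_nat_recr. Qed.

Let sum0 h : sum h 0 = 0. Proof. by rewrite /sum big_geq. Qed.

Let sum_ge0 h n : (forall t, 0 <= h t) -> 0 <= sum h n.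
Proof. by move=> h0; apply: sumr_ge0. Qed.

Let a_tele n : (n <= T)%N ->
  a n.+1 <= a 1%N - 3 / 4 * eta * sum G n + eta * L ^+ 2 * sum e n +
    L / 2 * eta ^+ 2 * sum q n.
Proof.
elim: n => [|n ih] nT; first by rewrite !sum0; lra.
by have := ih (ltnW nT); have := a_step n.+1 nT; rewrite !sumS; lra.
Qed.

Let q_sum n : (n <= T)%N ->
  sum q n <= A * sum b n + (B + 1) * sum G n + C * n%:R.
Proof.
elim: n => [|n ih] nT; first by rewrite !sum0; lra.
by have := ih (ltnW nT); have := q_le n.+1 nT; rewrite !sumS -natr1; lra.
Qed.

Let b_sum n : (n <= T)%N -> sum b n <= 2 * sum a n + L * sum e n.
Proof.
elim: n => [|n ih] nT; first by rewrite !sum0; lra.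
by have := ih (ltnW nT); have := b_le n.+1 nT; rewrite !sumS; lra.
Qed.

Let etaL : L * eta <= 1 / 4.
Proof.
apply: le_trans etaB; rewrite ler_pM2r// ler_peMr ?ltW//.
by have := B_gt0; lra.
Qed.

Let q_eta n : (n <= T)%N ->
  L * eta ^+ 2 * sum q n <=
  L * A * eta ^+ 2 * sum b n + eta / 4 * sum G n + L * C * eta ^+ 2 * n%:R.
Proof.
move=> nT.
have h1 : 0 <= L * eta ^+ 2 by rewrite mulr_ge0 ?sqr_ge0// ltW.
have := ler_wpM2l h1 (q_sum n nT).
have h2 : 0 <= eta * sum G n by rewrite mulr_ge0 ?sum_ge0// ltW.
have := ler_wpM2r h2 etaB.
by lra.
Qed.

(** By [e_sum] and [etaL] the drift costs at most half of [L * eta ^+ 2 * sum q n], and the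
    smoothness error is the other half. Applying [q_eta] to the whole costs [eta / 4 * sum G n] and
    leaves 3/4 - 1/4 = 1/2. *)
Let a_tele2 n : (n <= T)%N ->
  a n.+1 + eta / 2 * sum G n <=
  a 1%N + L * A * eta ^+ 2 * sum b n + L * C * eta ^+ 2 * n%:R.
Proof.
move=> nT.
have h1 : 0 <= eta * L ^+ 2 by rewrite mulr_ge0 ?sqr_ge0// ltW.
have := ler_wpM2l h1 (e_sum n nT); rewrite -!/(sum _ _).
have h2 : 0 <= L * eta ^+ 2 * sum q n.
  by rewrite !mulr_ge0 ?sqr_ge0 ?sum_ge0// ltW.
have := ler_wpM2r h2 etaL.
by have := a_tele n nT; have := q_eta n nT; lra.
Qed.

Let noise n : (n <= T)%N -> L * C * eta ^+ 2 * n%:R <= 2 / 3.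
Proof.
move=> nT; apply: le_trans etaCT; rewrite ler_wpM2l ?ler_nat//.
by rewrite !mulr_ge0 ?sqr_ge0// ltW.
Qed.

(** Bounding the drift through [q_eta] brings back [sum b n] with coefficient
    [2 * (L * A * eta ^+ 2) <= 1 / 10]; moving it to the left gives the factor 10/9. *)
Let b_sum2 n : (n <= T)%N ->
  sum b n <= 10 / 9 * (2 * sum a n + eta / 2 * sum G n + 4 / 3).
Proof.
move=> nT.
have := ler_wpM2l (ltW L_gt0) (e_sum n nT); rewrite -!/(sum _ _).
have := ler_wpM2r (sum_ge0 b n b_ge0) etaA.
by have := b_sum n nT; have := q_eta n nT; have := noise n nT; lra.
Qed.

(** The constant is 2/3 from [noise] plus 1/20 * 10/9 * 4/3 from inserting [b_sum2] into
    [a_tele2]. *)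
Let c0 := a 1%N + 20 / 27.

(** The sum of [a] must be damped by 1/T, hence [etaAT] and 1/3 * 10/9 * 2 = 20/27. For the gradient
    sum [etaA] is enough: 1/2 - 1/36 = 17/36. *)
Let a_rec n : (n <= T)%N ->
  a n.+1 + 17 / 36 * eta * sum G n <= c0 + 20 / 27 * (sum a n / T%:R).
Proof.
move=> nT.
have T0 : 0 < T%:R :> R by rewrite ltr0n.
have u0 : 0 <= L * A * eta ^+ 2 by rewrite !mulr_ge0 ?sqr_ge0// ltW.
have h1 := ler_wpM2l u0 (b_sum2 n nT).
have h2 : L * A * eta ^+ 2 * sum a n <= 1 / 3 * (sum a n / T%:R).
  by rewrite (mulrA (1 / 3)) ler_pdivlMr// mulrAC ler_wpM2r// sum_ge0.
have h3 : 0 <= eta * sum G n by rewrite mulr_ge0 ?sum_ge0// ltW.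
have h4 := ler_wpM2r h3 etaA.
have := a_tele2 n nT; have := noise n nT; have := etaA; rewrite /c0.
by lra.
Qed.

(* The growth rate 6/5 is consistent because 20/27 * (1 + 3/5) <= 6/5. *)
Let a_bound n : (n <= T)%N ->
  sum a n <= c0 * (n%:R + 3 / 5 * (n%:R ^+ 2 / T%:R)) /\
  a n.+1 <= c0 * (1 + 6 / 5 * (n%:R / T%:R)).
Proof.
have T0 : 0 < T%:R :> R by rewrite ltr0n.
have Ti : 0 <= T%:R^-1 :> R by rewrite invr_ge0 ltW.
have c00 : 0 <= c0 by rewrite /c0; have := a_ge0 1%N; lra.
elim: n => [|n ih] nT.
  by rewrite sum0 /c0 expr0n/= !mul0r; lra.
have [ih1 ih2] := ih (ltnW nT).
have h1 : sum a n.+1 <= c0 * (n.+1%:R + 3 / 5 * (n.+1%:R ^+ 2 / T%:R)).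
  (* The sum of the two induction hypotheses stays below the target by exactly
     [3 / 5 * c0 / T%:R]. *)
  rewrite sumS; apply: le_trans (lerD ih1 ih2) _.
  have := mulr_ge0 c00 Ti; rewrite -natr1; lra.
split => //.
have := a_rec n.+1 nT.
have h3 : 0 <= eta * sum G n.+1 by rewrite mulr_ge0 ?sum_ge0// ltW.
have nT1 : n.+1%:R / T%:R <= 1 :> R by rewrite ler_pdivrMr// mul1r ler_nat.
have nT0 : 0 <= n.+1%:R / T%:R :> R by rewrite divr_ge0.
(* As [n.+1 <= T], the quadratic term is at most 3/5 of the linear one, and 1 + 3/5 = 8/5. *)
have h4 : sum a n.+1 / T%:R <= c0 * (8 / 5) * (n.+1%:R / T%:R).
  rewrite mulrA ler_wpM2r//; apply: (le_trans h1).
  rewrite -(mulrA c0) ler_wpM2l// expr2 -(mulrA n.+1%:R).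
  have : n.+1%:R * (n.+1%:R / T%:R) <= n.+1%:R :> R by rewrite ler_piMr.
  by lra.
have := mulr_ge0 c00 nT0.
by lra.
Qed.

(** The factor [2 * T%:R * (4 * a 1%N + 8)] is a bound for the sum of [b] up to [T], available once
    [a] is under control; [a_tele2] at [n = T] then concludes. *)
Lemma recursion_bound :
  eta / 2 * \sum_(1 <= t < T.+1) G t <=
  a 1%N + L * A * eta ^+ 2 * (2 * T%:R * (4 * a 1%N + 8)) +
    L * C * eta ^+ 2 * T%:R.
Proof.
rewrite -/(sum G T).
have T1 : 1 <= T%:R :> R by rewrite ler1n.
have T0 : 0 < T%:R :> R by rewrite ltr0n.
have [h1 _] := a_bound T (leqnn T).
have {}h1 : sum a T <= 8 / 5 * c0 * T%:R.
  apply: le_trans h1 _; rewrite expr2 mulfK ?gt_eqF//; lra.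
have h2 : sum a T / T%:R <= 8 / 5 * c0 by rewrite ler_pdivrMr.
have h3 := a_rec T (leqnn T).
have h4 := b_sum2 T (leqnn T).
have c00 : 20 / 27 <= c0 by rewrite /c0; have := a_ge0 1%N; lra.
have h5 : c0 <= c0 * T%:R by rewrite ler_peMr//; lra.
(* [h3] bounds [eta * sum G T] by a multiple of [c0], so [h4] gives less than
   [6.2 * c0 * T + 3 / 2]. *)
have h6 : sum b T <= 2 * T%:R * (4 * a 1%N + 8).
  have := a_ge0 T.+1.
  have : 0 <= a 1%N * T%:R by rewrite mulr_ge0.
  move: h5; rewrite /c0 in h1 h2 h3 c00 *.
  by lra.
have u0 : 0 <= L * A * eta ^+ 2 by rewrite !mulr_ge0 ?sqr_ge0// ltW.
have := ler_wpM2l u0 h6.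
by have := a_tele2 T (leqnn T); have := a_ge0 T.+1; lra.
Qed.

End recursion.

(** * The step size *)

Lemma invr_min_le (R : realFieldType) (x y : R) : 0 < x -> 0 < y ->
  (Num.min x y)^-1 <= x^-1 + y^-1.
Proof.
move=> x0 y0; have xi : 0 <= x^-1 by rewrite invr_ge0 ltW.
have yi : 0 <= y^-1 by rewrite invr_ge0 ltW.
by case: (leP x y) => _; lra.
Qed.

Section stepsize.
Context {R : realType} {T : nat} {L A B C D1 : R}.
Hypotheses (T_ge1 : (1 <= T)%N) (L_gt0 : 0 < L) (A_gt0 : 0 < A)
  (B_gt0 : 0 < B) (C_gt0 : 0 < C) (D1_ge0 : 0 <= D1).

Let Deltae : R := 4 * D1 + 8.
Let K : R := A * Deltae + 2 * L * (B + 1) * Deltae + C.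
Let e1 : R := 1 / Num.sqrt (3 * L * A * T%:R).
Let e2 : R := Num.sqrt (2 / (3 * L * C * T%:R)).
Let e3 : R := Num.sqrt (2 / (5 * L * K)).
Let e4 : R := 1 / (4 * L * (B + 1)).
Let eta : R := Num.min (Num.min (Num.min e1 e2) e3) e4.

Let T0 : 0 < T%:R :> R. Proof. by rewrite ltr0n. Qed.

(** The 8 in [Deltae] makes [A / K] at most 1/8, so that [e3] yields 2/5 * 1/8 = 1/20 in
    [stepsize_A]. *)
Let K_ge : 8 * A <= K.
Proof.
have h1 : 0 <= A * D1 by rewrite mulr_ge0// ltW.
have h2 : 0 <= L * (B + 1) * Deltae.
  have De0 : 0 <= Deltae by rewrite addr_ge0// mulr_ge0.
  by rewrite mulr_ge0// mulr_ge0 ?ltW// addr_gt0.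
have := C_gt0; have := A_gt0; rewrite /K /Deltae in h2 *.
by lra.
Qed.

Let K_gt0 : 0 < K. Proof. by have := K_ge; have := A_gt0; lra. Qed.

Let e1_gt0 : 0 < e1.
Proof. by rewrite divr_gt0// sqrtr_gt0 !mulr_gt0. Qed.

Let e2_gt0 : 0 < e2.
Proof. by rewrite sqrtr_gt0 divr_gt0// !mulr_gt0. Qed.

Let e3_gt0 : 0 < e3.
Proof. by rewrite sqrtr_gt0 divr_gt0// !mulr_gt0. Qed.

Let e4_gt0 : 0 < e4.
Proof. by rewrite divr_gt0// !mulr_gt0// addr_gt0. Qed.

Lemma stepsize_gt0 : 0 < eta.
Proof. by rewrite /eta !lt_min e1_gt0 e2_gt0 e3_gt0 e4_gt0. Qed.

Let eta_le : [/\ eta <= e1, eta <= e2, eta <= e3 & eta <= e4].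
Proof. by rewrite /eta !ge_min !lexx ?orbT. Qed.

Let sq_le x : eta <= x -> eta ^+ 2 <= x ^+ 2.
Proof.
move=> h; have e0 := ltW stepsize_gt0.
by rewrite lerXn2r// nnegrE// (le_trans e0 h).
Qed.

Lemma stepsize_B : L * (B + 1) * eta <= 1 / 4.
Proof.
have [_ _ _ h] := eta_le.
have B1 : 0 < B + 1 by rewrite addr_gt0.
apply: (@le_trans _ _ (L * (B + 1) * e4)).
  by rewrite ler_wpM2l// mulr_ge0// ltW.
rewrite le_eqVlt; apply/orP; left; apply/eqP.
by rewrite /e4; field; rewrite !gt_eqF.
Qed.

Lemma stepsize_AT : L * A * eta ^+ 2 * T%:R <= 1 / 3.
Proof.
have [h _ _ _] := eta_le.
apply: (@le_trans _ _ (L * A * e1 ^+ 2 * T%:R)).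
  by rewrite ler_wpM2r ?ler_wpM2l ?sq_le ?mulr_ge0// ltW.
rewrite /e1 expr_div_n sqr_sqrtr ?expr1n; last by rewrite !mulr_ge0// ltW.
by rewrite le_eqVlt; apply/orP; left; apply/eqP; field; rewrite !gt_eqF.
Qed.

Lemma stepsize_CT : L * C * eta ^+ 2 * T%:R <= 2 / 3.
Proof.
have [_ h _ _] := eta_le.
apply: (@le_trans _ _ (L * C * e2 ^+ 2 * T%:R)).
  by rewrite ler_wpM2r ?ler_wpM2l ?sq_le ?mulr_ge0// ltW.
rewrite /e2 sqr_sqrtr; last by rewrite divr_ge0// !mulr_ge0// ltW.
by rewrite le_eqVlt; apply/orP; left; apply/eqP; field; rewrite !gt_eqF.
Qed.

Lemma stepsize_A : L * A * eta ^+ 2 <= 1 / 20.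
Proof.
have [_ _ h _] := eta_le.
apply: (@le_trans _ _ (L * A * e3 ^+ 2)).
  by rewrite ler_wpM2l ?sq_le ?mulr_ge0// ltW.
rewrite /e3 sqr_sqrtr; last by rewrite divr_ge0// !mulr_ge0// ltW.
have -> : L * A * (2 / (5 * L * K)) = 2 / 5 * (A / K) by field; rewrite !gt_eqF.
have : A / K <= 1 / 8 by rewrite ler_pdivrMr//; have := K_ge; lra.
by lra.
Qed.

(** The reciprocal of the minimum is at most the sum of the four reciprocals: those of [e1] and [e2]
    grow like sqrt T, those of [e3] and [e4] do not depend on [T]. *)
Let inv_eta_le : eta^-1 <=
  Num.sqrt T%:R * (Num.sqrt (3 * L * A) + Num.sqrt (3 * L * C / 2)) +
  (Num.sqrt (5 * L * K / 2) + 4 * L * (B + 1)).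
Proof.
have p12 : 0 < Num.min e1 e2 by rewrite lt_min e1_gt0.
have p123 : 0 < Num.min (Num.min e1 e2) e3 by rewrite lt_min p12.
apply: le_trans (invr_min_le _ _ _ p123 e4_gt0) _.
have := invr_min_le _ _ _ p12 e3_gt0; have := invr_min_le _ _ _ e1_gt0 e2_gt0.
have LA : 0 <= 3 * L * A by rewrite !mulr_ge0// ltW.
have LC : 0 <= 3 * L * C / 2 by rewrite divr_ge0// !mulr_ge0// ltW.
have -> : e1^-1 = Num.sqrt T%:R * Num.sqrt (3 * L * A).
  by rewrite /e1 div1r invrK sqrtrM// mulrC.
have -> : e2^-1 = Num.sqrt T%:R * Num.sqrt (3 * L * C / 2).
  rewrite /e2 -sqrtrV// ?divr_ge0 ?mulr_ge0 ?ltW//.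
  by rewrite -sqrtrM ?ltW//; congr Num.sqrt; field; rewrite !gt_eqF.
have -> : e3^-1 = Num.sqrt (5 * L * K / 2).
  rewrite /e3 -sqrtrV// ?divr_ge0 ?mulr_ge0 ?ltW//.
  by rewrite invf_div.
have -> : e4^-1 = 4 * L * (B + 1) by rewrite /e4 div1r invrK.
by lra.
Qed.

Let eta_LA : L * A * eta <= Num.sqrt (L * A) / Num.sqrt (3 * T%:R).
Proof.
have [h _ _ _] := eta_le.
have LA : 0 < L * A by rewrite mulr_gt0.
apply: (@le_trans _ _ (L * A * e1)); first by rewrite ler_wpM2l// ltW.
rewrite /e1 (_ : 3 * L * A * T%:R = L * A * (3 * T%:R)); last by ring.
rewrite (sqrtrM _ (ltW LA)).
rewrite -{1}(sqr_sqrtr (ltW LA)) le_eqVlt; apply/orP; left; apply/eqP.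
have sLA : 0 < Num.sqrt (L * A) by rewrite sqrtr_gt0.
have s3 : 0 < Num.sqrt (3 * T%:R : R) by rewrite sqrtr_gt0 mulr_gt0.
by field; rewrite !gt_eqF.
Qed.

Let eta_LC : L * C * eta <= Num.sqrt (2 * L * C) / Num.sqrt (3 * T%:R).
Proof.
have [_ h _ _] := eta_le.
have LC : 0 < L * C by rewrite mulr_gt0.
apply: (@le_trans _ _ (L * C * e2)); first by rewrite ler_wpM2l// ltW.
rewrite /e2 -[X in X * _](ger0_norm (ltW LC)) -sqrtr_sqr.
rewrite -sqrtrV; last by rewrite mulr_ge0.
rewrite -!sqrtrM ?sqr_ge0//; last by rewrite !mulr_ge0// ltW.
rewrite le_eqVlt; apply/orP; left; apply/eqP.
by congr Num.sqrt; field; rewrite !gt_eqF.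
Qed.

(** Dividing by [eta / 2 * T%:R] leaves one term in [eta^-1], bounded by [inv_eta_le], and two terms
    linear in [eta], bounded by [eta_LA] and [eta_LC]. *)
Lemma stepsize_conclusion (S : R) :
  eta / 2 * S <= D1 + L * A * eta ^+ 2 * (2 * T%:R * Deltae) +
    L * C * eta ^+ 2 * T%:R ->
  T%:R^-1 * S <=
   2 * D1 / Num.sqrt T%:R
      * (Num.sqrt (3 * L * A) + Num.sqrt (3 * L * C / 2))
    + 4 / Num.sqrt (3 * T%:R)
      * (Deltae * Num.sqrt (L * A) + Num.sqrt (2 * L * C))
    + 2 * D1 / T%:R
      * (Num.sqrt (5 * L * K / 2) + 4 * L * (B + 1)).
Proof.
move=> hS; have e0 := stepsize_gt0.
have De0 : 0 <= Deltae by rewrite addr_ge0// mulr_ge0.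
have h1 : T%:R^-1 * S <= 2 * D1 / T%:R * eta^-1 + 4 * Deltae * (L * A * eta)
    + 2 * (L * C * eta).
  rewrite -(ler_pM2l (_ : 0 < eta / 2 * T%:R)) ?mulr_gt0 ?invr_gt0//.
  have -> : eta / 2 * T%:R * (T%:R^-1 * S) = eta / 2 * S.
    by field; rewrite gt_eqF.
  apply: le_trans hS _; rewrite le_eqVlt; apply/orP; left; apply/eqP.
  by field; rewrite !gt_eqF.
apply: le_trans h1 _.
have h2 : 0 <= 2 * D1 / T%:R by rewrite divr_ge0// mulr_ge0.
have h3 := ler_wpM2l h2 inv_eta_le.
have h4 := ler_wpM2l De0 eta_LA.
have := eta_LC.
have sT : Num.sqrt T%:R / T%:R = (Num.sqrt T%:R)^-1 :> R.
  have s0 : 0 < Num.sqrt T%:R :> R by rewrite sqrtr_gt0.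
  by rewrite -{2}(sqr_sqrtr (ltW T0)); field; rewrite gt_eqF.
rewrite -sT.
(* The [L * C] term arises with coefficient 2 against the stated 4; nonnegativity covers the
   difference. *)
have s3 : 0 <= (Num.sqrt (3 * T%:R))^-1 :> R by rewrite invr_ge0 sqrtr_ge0.
have := mulr_ge0 (sqrtr_ge0 (2 * L * C)) s3.
by lra.
Qed.

End stepsize.

(** * Borel sets of R^d *)

Section borel_rV.
Context {R : realType} {d : nat}.
Notation borel := (g_sigma_algebraType (@open 'rV[R]_d)).

Lemma continuous_borel (f : 'rV[R]_d -> R) :
  continuous f -> measurable_fun [set: borel] (f : borel -> R).
Proof.
move=> /continuousP cf.
apply: (measurability _ (RGenOpens.measurableE R)).
move=> _ [_ [a [b ->] <-]]; rewrite setTI.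
by apply: sub_sigma_algebra; exact/cf/interval_open.
Qed.

Lemma measurable_coord i :
  measurable_fun [set: borel] (fun u : borel => (u : 'rV[R]_d) ord0 i).
Proof. by apply: continuous_borel => u; exact: coord_continuous. Qed.

(** Boxes with rational centres and radii 1/(n+1) form a countable base of the topology. *)
Let box (q : 'rV[rat]_d) (n : nat) : set 'rV[R]_d :=
  [set y | forall i, `|ratr (q ord0 i) - y ord0 i| < n.+1%:R^-1].

Let box_preimage dS (S : measurableType dS) (h : S -> borel) q n :
  (forall i, measurable_fun [set: S] (fun s => (h s : 'rV[R]_d) ord0 i)) ->
  measurable (h @^-1` box q n).
Proof.
move=> mh.
have -> : h @^-1` box q n = \bigcap_(i in [set: 'I_d])
    ((fun s => (h s : 'rV[R]_d) ord0 i) @^-1`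
       (ball (ratr (q ord0 i) : R) n.+1%:R^-1)).
  by apply/seteqP; split => s /= hs i; [move=> _|]; exact: hs.
apply: fin_bigcap_measurable => // i _.
rewrite -[X in measurable X]setTI; apply: mh => //.
by apply: open_measurable; exact: ball_open.
Qed.

(** Every open set is a countable union of boxes, and the preimage of a box is a finite intersection
    of coordinate preimages. *)
Lemma measurable_rV dS (S : measurableType dS) (h : S -> borel) :
  (forall i, measurable_fun [set: S] (fun s => (h s : 'rV[R]_d) ord0 i)) ->
  measurable_fun [set: S] h.
Proof.
move=> mh; apply: (@measurability _ _ S borel _ _ (@open 'rV[R]_d)) => //.
move=> _ [U oU <-].
rewrite setTI.
pose F (qn : 'rV[rat]_d * nat) : set S :=
  if `[< box qn.1 qn.2 `<=` U >] then h @^-1` box qn.1 qn.2 else set0.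
suff -> : h @^-1` U = \bigcup_qn F qn.
  apply: countable_bigcupT_measurable; first exact: countableP.
  by move=> qn; rewrite /F; case: ifPn => // _; exact: box_preimage.
apply/seteqP; split => [s /= Us|s /= [qn _]]; last first.
  by rewrite /F; case: ifPn => // /asboolP bU /= /bU.
have /nbhs_ballP[e /= e0 eU] : nbhs (h s : 'rV[R]_d) U by apply: open_nbhs_nbhs.
(* A box of radius below [e / 2] that contains [h s] lies in the ball of radius [e] around [h s]. *)
have [n ne] := ltr_add_invr (divr_gt0 e0 (ltr0n R 2)).
rewrite add0r in ne; set r := n.+1%:R^-1 in ne.
have r0 : 0 < r by rewrite invr_gt0.
have /choice[q hq] (i : 'I_d) : exists q : rat,
    ratr q \in `](h s : 'rV[R]_d) ord0 i - r, (h s : 'rV[R]_d) ord0 i + r[%R.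
  by apply: rat_in_itvoo; lra.
exists (\row_i q i, n) => //; rewrite /F asboolT => [|y /= hy].
  move=> i /=; rewrite mxE; have := hq i; rewrite in_itv/= => ?.
  by rewrite ltr_distl.
apply: eU; split => // i j; rewrite (ord1 i); have := hy j; have := hq j.
rewrite mxE in_itv/= /ball/= !ltr_distlC -/r => /andP[h1 h2] /andP[h3 h4].
by apply/andP; split; lra.
Qed.

End borel_rV.

(** * Independence of the state and the next sample *)

(** Rectangles form a pi-system generating the product sigma-algebra, and finiteness of [m1] gives
    access to the uniqueness theorem for measures. *)
Lemma measure_rectangle_ext {R : realType} {d1 d2} {S : measurableType d1}
    {Z : measurableType d2} (m1 m2 : {measure set (S * Z) -> \bar R}) :
  (forall A E, measurable A -> measurable E ->
    m1 (A `*` E) = m2 (A `*` E)) ->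
  (m1 setT < +oo)%E ->
  forall B, measurable B -> m1 B = m2 B.
Proof.
move=> h fin; pose C : set (set (S * Z)) :=
  [set A `*` E | A in measurable & E in measurable].
apply: (measure_unique (C : set (set (S * Z))) (fun=> setT)) => //.
- exact: measurable_prod_measurableType.
- move=> _ _ [A mA [E mE <-]] [A' mA' [E' mE' <-]].
  rewrite -setXI; exists (A `&` A'); first exact: measurableI.
  by exists (E `&` E') => //; exact: measurableI.
- by move=> _; exists setT => //; exists setT => //; rewrite setXTT.
- by rewrite bigcup_const//; exists 0%N.
- by move=> _ [A mA [E mE <-]]; exact: h.
Qed.

Section fresh_sample.
Context {R : realType} {dO dZ dS : measure_display}.
Context {Omega : measurableType dO} {Z : measurableType dZ}
  {S : measurableType dS} {P : probability Omega R} {D : probability Z R}.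
Context {T : nat} {z : nat -> {RV P >-> Z}}.
Context {X : nat -> Omega -> S} {F : nat -> S * Z -> S} {s1 : S}.
Hypotheses (z_iid : iid_samples D T z) (X1 : forall w, X 1%N w = s1).
Hypothesis XS : forall t w, (1 <= t <= T)%N -> X t.+1 w = F t (X t w, z t w).
Hypothesis mF : forall t, (1 <= t <= T)%N -> measurable_fun setT (F t).

Lemma measurable_state t : (1 <= t <= T.+1)%N -> measurable_fun setT (X t).
Proof.
elim: t => // -[_ _|t ih /andP[_ tT]].
  rewrite (_ : X 1%N = cst s1); first exact: measurable_cst.
  by apply/funext => w; rewrite X1.
have t1T : (1 <= t.+1 <= T)%N by [].
rewrite (_ : X t.+2 = F t.+1 \o (fun w => (X t.+1 w, z t.+1 w))); last first.
  by apply/funext => w; rewrite XS.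
apply: measurableT_comp; first exact: mF.
by apply: measurable_fun_pair => //; apply: ih; exact: ltnW.
Qed.

Let future (J : seq nat) (E : nat -> set Z) : set Omega :=
  \bigcap_(j in [set` J]) (z j @^-1` E j).

Let measurable_future J E : (forall j, measurable (E j)) ->
  measurable (future J E).
Proof.
move=> mE; apply: fin_bigcap_measurable => // j _.
exact: measurable_funPTI.
Qed.

Let future_cons t J E : future (t :: J) E = (z t @^-1` E t) `&` future J E.
Proof.
apply/seteqP; split=> w /= => [h|[h1 h2] j /=].
  split; first by apply: (h t); rewrite /= mem_head.
  by move=> j /= jJ; apply: (h j); rewrite /= inE jJ orbT.
by rewrite inE => /orP[/eqP ->//|]; exact: h2.
Qed.

Let future1 t E : future [:: t] E = z t @^-1` E t.
Proof.
rewrite future_cons (_ : future [::] E = setT) ?setIT//.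
by apply/seteqP; split.
Qed.

Let eq_future J E E' : {in J, forall j, E j = E' j} -> future J E = future J E'.
Proof. by move=> EE'; apply: eq_bigcapr => j jJ; rewrite EE'. Qed.


(** The next state depends on the current state and sample, so the induction must carry independence
    from all later samples jointly, not only from [z t]. *)
Lemma state_independent_future t J E A : (1 <= t <= T.+1)%N -> uniq J ->
  (forall j, j \in J -> (t <= j <= T)%N) -> (forall j, measurable (E j)) ->
  measurable A ->
  P (X t @^-1` A `&` future J E) =
    (P (X t @^-1` A) * \prod_(j <- J) D (E j))%E.
Proof.
elim: t J E A => // -[_|t ih] J E A tT uJ JT mE mA.
  have [As|As] := pselect (A s1); last first.
    rewrite (_ : X 1%N @^-1` A = set0) ?set0I ?measure0 ?mul0e//.
    by apply/seteqP; split => // w /=; rewrite X1.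
  rewrite (_ : X 1%N @^-1` A = setT); last first.
    by apply/seteqP; split => // w /=; rewrite X1.
  rewrite setTI probability_setT mul1e z_iid.2//.
  apply: eq_big_seq => j jJ; rewrite -(z_iid.1 j)//; exact: JT.
have tT' : (1 <= t.+1 <= T)%N by [].
have tT1 : (1 <= t.+1 <= T.+1)%N by rewrite /= ltnW.
have mW := measurable_future J E mE.
pose Y w := (X t.+1 w, z t.+1 w).
have mY : measurable_fun setT Y.
  by apply: measurable_fun_pair => //; exact: measurable_state.
have c0 : 0 <= fine (\prod_(j <- J) D (E j))%E.
  by rewrite fine_ge0// prode_ge0.
have cE : ((fine (\prod_(j <- J) D (E j)))%:E = \prod_(j <- J) D (E j))%E.
  by rewrite fineK// prode_fin_num// => j _; exact: fin_num_measure.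
(* [pushforward] is a measure only along a measurable map, so its structure is
   not inferred. *)
pose push_Y (m : {measure set Omega -> \bar R}) :
    {measure set (S * Z) -> \bar R} :=
  measure_function_pushforward__canonical__measure_function_Measure m mY.
pose m1 := push_Y (mrestr P mW).
pose m2 : {measure set (S * Z) -> \bar R} := mscale (NngNum c0) (push_Y P).
have m12 : forall B, measurable B -> m1 B = m2 B.
  apply: measure_rectangle_ext => [A0 E0 mA0 mE0|]; last first.
    rewrite /= /pushforward preimage_setT /mrestr setTI.
    by rewrite ltey_eq fin_num_measure.
  rewrite /= /mscale/= /pushforward /mrestr cE.
  pose E' j := if j == t.+1 then E0 else E j.
  have mE' j : measurable (E' j) by rewrite /E'; case: ifP.
  have tJ : t.+1 \notin J by apply/negP => /JT; rewrite ltnn.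
  have EE' : {in J, forall j, E j = E' j}.
    by move=> j jJ; rewrite /E'; case: eqP tJ => // <-; rewrite jJ.
  have YE : Y @^-1` (A0 `*` E0) = X t.+1 @^-1` A0 `&` (z t.+1 @^-1` E0) by [].
  have -> : P (Y @^-1` (A0 `*` E0)) = (P (X t.+1 @^-1` A0) * D E0)%E.
    have := ih [:: t.+1] (fun=> E0) A0 tT1; rewrite big_seq1 => <- //.
      by rewrite YE future1.
    by move=> j; rewrite inE => /eqP ->; rewrite leqnn; case/andP: tT'.
  have := ih (t.+1 :: J) E' A0 tT1; rewrite big_cons.
  rewrite [in E' t.+1]/E' eqxx.
  rewrite (eq_big_seq _ (fun j jJ => congr1 D (esym (EE' j jJ)))).
  rewrite future_cons -(eq_future J E E' EE') [in E' t.+1]/E' eqxx.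
  rewrite YE -setIA => ->//; first by rewrite muleA muleC.
    by rewrite /= tJ.
  move=> j; rewrite inE => /orP[/eqP ->|/JT/andP[tj ->]].
    by rewrite leqnn; case/andP: tT'.
  by rewrite (ltnW tj).
have mB : measurable (F t.+1 @^-1` A).
  by rewrite -[_ @^-1` _]setTI; apply: mF.
have := m12 _ mB.
rewrite /= /mscale/= /pushforward /mrestr cE muleC.
suff -> : X t.+2 @^-1` A = Y @^-1` (F t.+1 @^-1` A) by [].
by apply/seteqP; split => w /=; rewrite XS.
Qed.

Lemma state_sample_law t A E :
  (1 <= t <= T)%N -> measurable A -> measurable E ->
  P ((fun w => (X t w, z t w)) @^-1` (A `*` E)) = (P (X t @^-1` A) * D E)%E.
Proof.
move=> tT mA mE.
have h := @state_independent_future t [:: t] (fun=> E) A.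
rewrite big_seq1 in h; rewrite -h//; last 2 first.
- by move: tT => /andP[-> /=]; exact: leqW.
- by move=> j; rewrite inE => /eqP ->; rewrite leqnn; case/andP: tT.
by rewrite future1.
Qed.

(** The joint law of state and sample is a product, so Tonelli integrates the sample out at a frozen
    state. This stands in for conditioning on the past. *)
Lemma integral_fresh_sample t (h : S * Z -> \bar R) : (1 <= t <= T)%N ->
  measurable_fun setT h -> (forall p, 0 <= h p)%E ->
  (\int[P]_w h (X t w, z t w) = \int[P]_w \int[D]_y h (X t w, y))%E.
Proof.
move=> tT mh h0.
have tT1 : (1 <= t <= T.+1)%N by move: tT => /andP[-> /=]; exact: leqW.
have mX := measurable_state t tT1.
have mY : measurable_fun setT (fun w => (X t w, z t w)).
  exact: measurable_fun_pair.
pose X' : {mfun Omega >-> S} :=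
  HB.pack (X t) (isMeasurableFun.Build _ _ _ _ _ mX).
pose Y' : {mfun Omega >-> (S * Z)%type} :=
  HB.pack (fun w => (X t w, z t w)) (isMeasurableFun.Build _ _ _ _ _ mY).
transitivity (\int[distribution P Y']_p h p)%E.
  by rewrite ge0_integral_pushforward.
transitivity (\int[distribution P X' \x D]_p h p)%E.
  apply: eq_measure_integral => B mB _; apply/esym.
  apply: product_measure_unique => // A E mA mE.
  exact: state_sample_law.
rewrite fubini_tonelli1// ge0_integral_pushforward//.
  exact: measurable_fun_fubini_tonelli_F.
by move=> s _; apply: integral_ge0.
Qed.

End fresh_sample.

(** * Means and the stochastic gradient *)

Section mean.
Context {dT : measure_display} {T : measurableType dT} {R : realType}.
Variable P : probability T R.
Implicit Types (u v : T -> R) (c k : R).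

(** Integrability and value travel together, so that the linearity lemmas carry no separate side
    conditions. *)
Definition has_mean u c : Prop :=
  P.-integrable [set: T] (EFin \o u) /\ (\int[P]_w (u w)%:E = c%:E)%E.

(** [fine] sends an infinite integral to 0, so this number is informative only next to
    [has_mean u (mean u)]. *)
Definition mean u : R := fine (\int[P]_w (u w)%:E).

Lemma has_meanE u c : has_mean u c -> mean u = c.
Proof. by rewrite /mean => -[_ ->]. Qed.

Lemma has_mean_cst k : has_mean (cst k) k.
Proof.
split; first exact: finite_measure_integrable_cst.
transitivity (\int[P]_w (cst k%:E) w)%E => //.
by rewrite integral_cst//= probability_setT mule1.
Qed.

Lemma has_meanD u v c k : has_mean u c -> has_mean v k ->
  has_mean (fun w => u w + v w) (c + k).
Proof.
move=> [iu Iu] [iv Iv]; split; first exact: (integrableD measurableT iu iv).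
by under eq_integral do rewrite EFinD; rewrite integralD// Iu Iv.
Qed.

Lemma has_meanZ k u c : has_mean u c -> has_mean (fun w => k * u w) (k * c).
Proof.
move=> [iu Iu]; split; first exact: (integrableZl measurableT k iu).
by under eq_integral do rewrite EFinM; rewrite integralZl// Iu.
Qed.

Lemma eq_has_mean u v c : u =1 v -> has_mean u c -> has_mean v c.
Proof. by move=> /funext ->. Qed.

Lemma has_mean_sum (I : eqType) (r : seq I) (u : I -> T -> R) (c : I -> R) :
  (forall i, i \in r -> has_mean (u i) (c i)) ->
  has_mean (fun w => \sum_(i <- r) u i w) (\sum_(i <- r) c i).
Proof.
elim: r => [_|i r ih h].
  rewrite big_nil; apply: eq_has_mean (has_mean_cst 0) => w.
  by rewrite big_nil.
rewrite big_cons.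
apply: (@eq_has_mean (fun w => u i w + \sum_(j <- r) u j w)).
  by move=> w; rewrite big_cons.
apply: has_meanD; first by apply: h; rewrite mem_head.
by apply: ih => j jr; apply: h; rewrite inE jr orbT.
Qed.

Lemma has_mean_le u v c k : has_mean u c -> has_mean v k ->
  (forall w, u w <= v w) -> c <= k.
Proof.
move=> [iu Iu] [iv Iv] uv; rewrite -lee_fin -Iu -Iv.
by apply: le_integral => // w _; rewrite lee_fin.
Qed.

Lemma ge0_has_mean u c : measurable_fun [set: T] u -> (forall w, 0 <= u w) ->
  (\int[P]_w (u w)%:E <= c%:E)%E -> has_mean u (mean u) /\ mean u <= c.
Proof.
move=> mu u0 uc.
have I0 : (0 <= \int[P]_w (u w)%:E)%E.
  by apply: integral_ge0 => w _; rewrite lee_fin.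
have fI : (\int[P]_w (u w)%:E)%E \is a fin_num.
  by rewrite ge0_fin_numE// (le_lt_trans uc)// ltry.
split; last by rewrite -lee_fin fineK.
split; last by rewrite fineK.
apply/integrableP; split; first exact/measurable_EFinP.
rewrite (eq_integral (fun w => (u w)%:E)) => [|w _].
  by rewrite -ge0_fin_numE.
by rewrite /= ger0_norm.
Qed.

Lemma has_mean_dom u v c : measurable_fun [set: T] u ->
  (forall w, 0 <= u w <= v w) -> has_mean v c -> has_mean u (mean u).
Proof.
move=> mu uv hv.
have u0 w : 0 <= u w by case/andP: (uv w).
apply: (proj1 (ge0_has_mean u c mu u0 _)); rewrite -hv.2.
apply: ge0_le_integral => //.
- by move=> w _; rewrite lee_fin.
- exact/measurable_EFinP.
- exact: measurable_int hv.1.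
- by move=> w _; rewrite lee_fin; case/andP: (uv w).
Qed.

Lemma mean_ge0 u : (forall w, 0 <= u w) -> 0 <= mean u.
Proof.
by move=> u0; apply: fine_ge0; apply: integral_ge0 => w _; rewrite lee_fin.
Qed.

End mean.

(** * First and second moments of the gradient oracle *)

Section oracle.
Context {R : realType} {dZ : measure_display} {Z : measurableType dZ}
  {D : probability Z R} {d : nat} {L A B C : R} {f : 'rV[R]_d -> R}
  {fz : 'rV[R]_d -> Z -> R} {g : 'rV[R]_d -> Z -> 'rV[R]_d}.
Hypotheses (L_gt0 : 0 < L) (f_smooth : smooth L f)
  (f_bounded_below : bounded_below f) (g_oracle : is_gradient_oracle fz g)
  (g_unbiased : unbiased D g f)
  (g_variance : relaxed_affine_variance D A B C g f).
Notation borel := (g_sigma_algebraType (@open 'rV[R]_d)).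

Lemma smooth_continuous : continuous f.
Proof. by move=> y; exact/differentiable_continuous/f_smooth.1. Qed.

Lemma measurable_oracle y i : measurable_fun [set: Z] (fun s => g y s ord0 i).
Proof. exact: (measurable_fun_pair2 (y : borel) (g_oracle.2 i)). Qed.

Lemma measurable_sqn dS (S : measurableType dS) (u : S -> 'rV[R]_d) :
  (forall i, measurable_fun [set: S] (fun s => u s ord0 i)) ->
  measurable_fun [set: S] (fun s => sqn (u s)).
Proof.
move=> mu; apply: measurable_sum => i.
by apply: measurable_funM.
Qed.

Lemma mean_oracle v y :
  has_mean D (fun s => dot v (g y s)) (dot v (gradient f y)).
Proof.
apply: has_mean_sum => i _; apply: has_meanZ.
have [h1 h2] := g_unbiased y i; split => //.
by move: h2; rewrite unlock.
Qed.

(** Bias-variance decomposition: E|g|^2 = E|g - m|^2 + |m|^2 with [m] the gradient, and the extra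
    |m|^2 turns [B] into [B + 1]. *)
Lemma mean_sqn_oracle y :
  has_mean D (fun s => sqn (g y s)) (mean D (fun s => sqn (g y s))) /\
  mean D (fun s => sqn (g y s)) <=
  A * (f y - inf_value f) + (B + 1) * sqn (gradient f y) + C.
Proof.
set m := gradient f y.
have [|s||h1 h2] := @ge0_has_mean _ _ _ D (fun s => sqn (g y s - m))
   (A * (f y - inf_value f) + B * sqn m + C).
- apply: measurable_sqn => i; under eq_fun do rewrite !mxE.
  by apply: measurable_funB => //; exact: measurable_oracle.
- exact: sqn_ge0.
- have := g_variance y; rewrite unlock enorm_sq -/m.
  by under eq_integral do rewrite enorm_sq.
have h3 := has_meanD _ _ _ _ _ h1 (has_meanD _ _ _ _ _
  (has_meanZ D 2 _ _ (mean_oracle m y)) (has_mean_cst D (- sqn m))).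
have h4 : has_mean D (fun s => sqn (g y s))
    (mean D (fun s => sqn (g y s - m)) + (2 * sqn m - sqn m)).
  apply: eq_has_mean h3 => s; rewrite /sqn !dotE (dotC m (g y s)) /=; ring.
rewrite (has_meanE _ _ _ h4); split => //.
by rewrite -/m; lra.
Qed.

(** The noise is averaged at frozen [x] and [y]: unbiasedness turns the inner product in [gap_step]
    into one of two gradients, to which [dot_gradient_ge] applies. *)
Lemma gap_step_mean eta x y : 0 < eta ->
  (\int[D]_s (f (x - eta *: g y s) - inf_value f)%:E <=
  (f x - inf_value f - 3 / 4 * eta * sqn (gradient f y)
   + eta * L ^+ 2 * sqn (x - y)
   + L / 2 * eta ^+ 2 * mean D (fun s => sqn (g y s)))%:E)%E.
Proof.
move=> eta0; have [h1 _] := mean_sqn_oracle y.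
have h := has_meanD _ _ _ _ _ (has_mean_cst D (f x - inf_value f))
  (has_meanD _ _ _ _ _
  (has_meanZ D (- eta) _ _ (mean_oracle (gradient f x) y))
  (has_meanZ D (L / 2 * eta ^+ 2) _ _ h1)).
apply: (@le_trans _ _ (f x - inf_value f +
  (- eta * dot (gradient f x) (gradient f y)
  + L / 2 * eta ^+ 2 * mean D (fun s => sqn (g y s))))%:E).
  rewrite -h.2; apply: ge0_le_integral => //.
  - by move=> s _; rewrite lee_fin subr_ge0 inf_value_le.
  - apply/measurable_EFinP; apply: measurable_funB => //.
    apply: (@measurableT_comp _ _ _ _ borel R (f : borel -> R) _
      (fun s => x - eta *: g y s : borel)).
      apply: continuous_borel; exact: smooth_continuous.
    apply: measurable_rV => i; under eq_fun do rewrite !mxE.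
    apply: measurable_funB => //; apply: measurable_funM => //.
    exact: measurable_oracle.
  - exact: measurable_int h.1.
  - move=> s _; rewrite lee_fin /=.
    by have := gap_step L_gt0 f_smooth eta x (g y s); lra.
rewrite lee_fin.
have := ler_wpM2l (ltW eta0) (dot_gradient_ge L_gt0 f_smooth x y).
by lra.
Qed.

Lemma measurable_gradient_sqn :
  measurable_fun [set: borel] (fun y : borel => sqn (gradient f y)).
Proof.
apply: measurable_sqn => i; apply: continuous_borel => y.
have FF : ProperFilter (nbhs y) by exact: nbhs_pfilter.
suff : gradient f v ord0 i @[v --> y] --> gradient f y ord0 i by [].
(* The Lipschitz bound is Euclidean while neighbourhoods come from the sup norm; continuity of [sqn]
   connects the two. *)
have sqn_cont : continuous (fun v : 'rV[R]_d => sqn (y - v)).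
  apply: continuous_big => [|j _ v]; first exact: add_continuous.
  have cj : (fun w : 'rV[R]_d => (y - w) ord0 j) @ v --> (y - v) ord0 j.
    rewrite !mxE (_ : (fun w : 'rV[R]_d => _) = fun w => y ord0 j - w ord0 j).
      by apply: continuousB; [exact: cst_continuous|exact: coord_continuous].
    by apply/funext => w; rewrite !mxE.
  exact: continuousM.
apply/(@cvgrPdist_lt _ _ _ (nbhs y)) => e e0.
have eL : 0 < (e / L) ^+ 2 by rewrite exprn_gt0// divr_gt0.
have : \forall v \near y, sqn (y - v) < (e / L) ^+ 2.
  have h : sqn (y - v) @[v --> y] --> sqn (y - y) := sqn_cont y.
  move: h; rewrite subrr sqn0 => /(@cvgrPdist_lt _ _ _ (nbhs y)) /(_ _ eL).
  by apply: filterS => v; rewrite sub0r normrN ger0_norm ?sqn_ge0.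
apply: filterS => v hv.
rewrite -ltr_sqr ?nnegrE ?(ltW e0)// real_normK ?num_real//.
have -> : gradient f y ord0 i - gradient f v ord0 i =
  (gradient f y - gradient f v) ord0 i by rewrite !mxE.
apply: le_lt_trans (ler_coord_sqn _ _) _.
apply: le_lt_trans (smooth_sqn L_gt0 f_smooth y v) _.
rewrite -ltr_pdivlMl ?exprn_gt0//.
by rewrite -exprVn -exprMn mulrC.
Qed.

End oracle.

(** * Expected progress along a run *)

Section run.
Context {R : realType} {dO dZ : measure_display}
  {Omega : measurableType dO} {P : probability Omega R}
  {Z : measurableType dZ} {D : probability Z R} {d T : nat}
  {f : 'rV[R]_d -> R} {fz : 'rV[R]_d -> Z -> R}
  {g : 'rV[R]_d -> Z -> 'rV[R]_d} {z : nat -> {RV P >-> Z}}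
  {L A B C eta : R} {x1 : 'rV[R]_d} {alpha theta gamma : nat -> R}
  {x xt xb : nat -> Omega -> 'rV[R]_d}.
Hypotheses (T_ge1 : (1 <= T)%N)
  (L_gt0 : 0 < L) (A_gt0 : 0 < A) (B_gt0 : 0 < B) (C_gt0 : 0 < C)
  (eta_gt0 : 0 < eta)
  (g_oracle : is_gradient_oracle fz g)
  (z_iid : iid_samples D T z)
  (f_smooth : smooth L f)
  (f_bounded_below : bounded_below f)
  (g_unbiased : unbiased D g f)
  (g_variance : relaxed_affine_variance D A B C g f)
  (run : forall w : Omega,
     agd_run T x1 alpha theta gamma g (fun t => z t w)
       (fun t => x t w) (fun t => xt t w) (fun t => xb t w)).
Hypothesis theta_eta : forall t, (1 <= t <= T)%N -> theta t = eta.
Notation borel := (g_sigma_algebraType (@open 'rV[R]_d)).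
Notation S := (borel * borel)%type.

(** This pair determines the query point and, together with [z t], the next pair; it is the state to
    which [integral_fresh_sample] applies. *)
Let X t w : S := (x t w, xt t w).

Let query t (s : S) : borel :=
  alpha t *: (s.1 : 'rV[R]_d) + (1 - alpha t) *: (s.2 : 'rV[R]_d).

Let oracle t (p : S * Z) : borel := g (query t p.1) p.2.

Let F t (p : S * Z) : S :=
  (1 *: (p.1.1 : 'rV[R]_d) + (- theta t) *: (oracle t p : 'rV[R]_d),
   1 *: (query t p.1 : 'rV[R]_d) + (- gamma t) *: (oracle t p : 'rV[R]_d)).

Let measurable_lin dS (S' : measurableType dS) (u v : S' -> borel) (k l : R) :
  measurable_fun [set: S'] u -> measurable_fun [set: S'] v ->
  measurable_fun [set: S'] (fun s =>
    k *: (u s : 'rV[R]_d) + l *: (v s : 'rV[R]_d) : borel).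
Proof.
move=> mu mv; apply: measurable_rV => i; under eq_fun do rewrite !mxE.
by apply: measurable_funD; apply: measurable_funM => //;
  apply: (measurableT_comp (measurable_coord i)).
Qed.

Let measurable_query t : measurable_fun [set: S] (query t).
Proof. exact: measurable_lin. Qed.

Let measurable_oracle_pair t : measurable_fun [set: (S * Z)%type] (oracle t).
Proof.
apply: measurable_rV => i.
apply: (measurableT_comp (g_oracle.2 i)
  (g := fun p : (S * Z)%type => (query t p.1, p.2))).
apply: measurable_fun_pair => //.
by apply: measurableT_comp.
Qed.

Let measurable_F t : measurable_fun [set: (S * Z)%type] (F t).
Proof.
apply: measurable_fun_pair; apply: measurable_lin => //.
- by apply: measurableT_comp.
- by apply: (measurableT_comp (measurable_query t)).
Qed.

Let xb_query t w : (1 <= t <= T)%N -> xb t w = query t (X t w).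
Proof. by move=> ht; have [_ _ /(_ t ht)[-> _ _]] := run w. Qed.

Let X1 w : X 1%N w = (x1, x1).
Proof. by rewrite /X; have [-> -> _] := run w. Qed.

Let XS t w : (1 <= t <= T)%N -> X t.+1 w = F t (X t w, z t w).
Proof.
move=> ht; rewrite /X /F /oracle -!xb_query//.
have [_ _ /(_ t ht)[_ -> ->]] := run w.
by rewrite !scale1r !scaleNr.
Qed.

Let measurable_X t : (1 <= t <= T.+1)%N -> measurable_fun [set: Omega] (X t).
Proof.
by move=> ht; apply: (measurable_state X1 XS) => // s _; exact: measurable_F.
Qed.

Let gap (y : 'rV[R]_d) : R := f y - inf_value f.

Let gap_ge0 y : 0 <= gap y.
Proof. by rewrite subr_ge0 inf_value_le. Qed.

Let second_moment (y : 'rV[R]_d) : R := mean D (fun s => sqn (g y s)).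

Let measurable_gap : measurable_fun [set: borel] (fun y : borel => gap y).
Proof.
apply: measurable_funB => //; apply: continuous_borel.
exact: smooth_continuous f_smooth.
Qed.

Let measurable_sqn_borel :
  measurable_fun [set: borel] (fun y : borel => sqn (y : 'rV[R]_d)).
Proof. by apply: measurable_sqn => i; exact: measurable_coord. Qed.

Let measurable_second_moment t :
  measurable_fun [set: S] (fun s => second_moment (query t s)).
Proof.
apply/measurable_EFinP.
(* As a function of the state, the second moment is the inner integral of Tonelli's theorem, which
   is measurable. *)
rewrite (_ : _ \o _ = fubini_F D (fun p : S * Z => (sqn (oracle t p))%:E)).
  apply: measurable_fun_fubini_tonelli_F => [|p].
    apply/measurable_EFinP.
    exact: (measurableT_comp measurable_sqn_borel (measurable_oracle_pair t)).
  by rewrite lee_fin sqn_ge0.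
apply/funext => s; apply/esym.
exact: (mean_sqn_oracle g_oracle g_unbiased g_variance (query t s)).1.2.
Qed.

Let x_ t w : borel := x t w.
Let xt_ t w : borel := xt t w.
Let xb_ t w : borel := xb t w.

Let measurable_x t : (1 <= t <= T.+1)%N -> measurable_fun [set: Omega] (x_ t).
Proof.
move=> ht; exact: (measurableT_comp (@measurable_fst _ _ borel borel)
  (measurable_X t ht)).
Qed.

Let measurable_xt t : (1 <= t <= T.+1)%N -> measurable_fun [set: Omega] (xt_ t).
Proof.
move=> ht; exact: (measurableT_comp (@measurable_snd _ _ borel borel)
  (measurable_X t ht)).
Qed.

Let widenT t : (1 <= t <= T)%N -> (1 <= t <= T.+1)%N.
Proof. by move=> /andP[-> /leqW]. Qed.

Let measurable_xb t : (1 <= t <= T)%N -> measurable_fun [set: Omega] (xb_ t).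
Proof.
move=> ht; rewrite (_ : xb_ t = query t \o X t).
  by apply: measurableT_comp => //; exact/measurable_X/widenT.
by apply/funext => w; exact: xb_query.
Qed.

Let measurable_sqnB (u v : Omega -> borel) :
  measurable_fun [set: Omega] u -> measurable_fun [set: Omega] v ->
  measurable_fun [set: Omega] (fun w => sqn ((u w : 'rV[R]_d) - v w)).
Proof.
move=> mu mv; under eq_fun do rewrite -[X in sqn (X - _)]scale1r -scaleN1r.
by apply: (measurableT_comp measurable_sqn_borel); exact: measurable_lin.
Qed.

Hypothesis potential_step : forall t w, (1 <= t <= T)%N ->
  t.+1%:R * sqn (x t.+1 w - xt t.+1 w) + sqn (x t w - xb t w) <=
  t%:R * sqn (x t w - xt t w) + 2 * eta ^+ 2 * sqn (g (xb t w) (z t w)).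
Hypothesis potential_ge : forall t w, (1 <= t <= T)%N ->
  sqn (x t w - xb t w) <= t%:R * sqn (x t w - xt t w).

(** Apart from the drift potential [pf], the means of these variables are the sequences of the
    scalar recursion. *)
Let af t w : R := gap (x t w).
Let bf t w : R := gap (xb t w).
Let ef t w : R := sqn (x t w - xb t w).
Let pf t w : R := t%:R * sqn (x t w - xt t w).
Let Gf t w : R := sqn (gradient f (xb t w)).
Let qf t w : R := sqn (g (xb t w) (z t w)).

Let mean_e t : (1 <= t <= T)%N -> has_mean P (pf t) (mean P (pf t)) ->
  has_mean P (ef t) (mean P (ef t)).
Proof.
move=> ht hp; apply: has_mean_dom hp; last first.
  by move=> w; rewrite sqn_ge0 potential_ge.
by apply: measurable_sqnB; [exact/measurable_x/widenT|exact: measurable_xb].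
Qed.

Let mean_b t : (1 <= t <= T)%N -> has_mean P (af t) (mean P (af t)) ->
  has_mean P (ef t) (mean P (ef t)) ->
  has_mean P (bf t) (mean P (bf t)) /\
  mean P (bf t) <= 2 * mean P (af t) + L * mean P (ef t).
Proof.
move=> ht ha he.
have h := has_meanD _ _ _ _ _ (has_meanZ _ 2 _ _ ha) (has_meanZ _ L _ _ he).
have hb : has_mean P (bf t) (mean P (bf t)).
  apply: has_mean_dom h.
    exact: (measurableT_comp measurable_gap (measurable_xb t ht)).
  by move=> w; rewrite gap_ge0 gap_shift.
by split => //; apply: has_mean_le hb h _ => w; rewrite gap_shift.
Qed.

Let mean_G t : (1 <= t <= T)%N -> has_mean P (bf t) (mean P (bf t)) ->
  has_mean P (Gf t) (mean P (Gf t)).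
Proof.
move=> ht hb; apply: has_mean_dom (has_meanZ _ (2 * L) _ _ hb).
  exact: (measurableT_comp (measurable_gradient_sqn L_gt0 f_smooth)
    (measurable_xb t ht)).
by move=> w; rewrite sqn_ge0 sqn_gradient_le.
Qed.

Let mean_q t : (1 <= t <= T)%N -> has_mean P (bf t) (mean P (bf t)) ->
  has_mean P (Gf t) (mean P (Gf t)) ->
  [/\ has_mean P (qf t) (mean P (qf t)),
      has_mean P (fun w => second_moment (xb t w)) (mean P (qf t)) &
      mean P (qf t) <= A * mean P (bf t) + (B + 1) * mean P (Gf t) + C].
Proof.
move=> ht hb hG.
have hm y := mean_sqn_oracle g_oracle g_unbiased g_variance y.
have h := has_meanD _ _ _ _ _ (has_meanD _ _ _ _ _ (has_meanZ _ A _ _ hb)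
  (has_meanZ _ (B + 1) _ _ hG)) (has_mean_cst P C).
have hsm : has_mean P (fun w => second_moment (xb t w))
    (mean P (fun w => second_moment (xb t w))).
  apply: has_mean_dom h => [|w].
    rewrite (_ : (fun w => _) = (fun s => second_moment (query t s)) \o X t).
      by apply: measurableT_comp => //; exact/measurable_X/widenT.
    by apply/funext => w /=; rewrite xb_query.
  by rewrite mean_ge0 ?(hm _).2// => s; exact: sqn_ge0.
(* The sample [z t] is independent of the state that determines the query point. *)
have qE : (\int[P]_w (qf t w)%:E = \int[P]_w (second_moment (xb t w))%:E)%E.
  transitivity (\int[P]_w (sqn (oracle t (X t w, z t w)))%:E)%E.
    by apply: eq_integral => w _; rewrite /qf xb_query.
  rewrite (integral_fresh_sample z_iid X1 XS (fun s _ => measurable_F s) t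
    (fun p => (sqn (oracle t p))%:E))//.
  - apply: eq_integral => w _; rewrite xb_query//.
    exact: (hm (query t (X t w))).1.2.
  - apply/measurable_EFinP.
    exact: (measurableT_comp measurable_sqn_borel (measurable_oracle_pair t)).
  - by move=> p; rewrite lee_fin sqn_ge0.
have qm : mean P (qf t) = mean P (fun w => second_moment (xb t w)).
  by rewrite /mean qE.
have hq : has_mean P (qf t) (mean P (qf t)).
  apply: (ge0_has_mean P (qf t) (mean P (qf t)) _ _ _).1.
  - rewrite (_ : qf t =
        (fun p => sqn (oracle t p)) \o (fun w => (X t w, z t w))).
      apply: measurableT_comp.
        exact: (measurableT_comp measurable_sqn_borel
          (measurable_oracle_pair t)).
      by apply: measurable_fun_pair => //; exact/measurable_X/widenT.
    by apply/funext => w; rewrite /qf xb_query.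
  - by move=> w; exact: sqn_ge0.
  - by rewrite qE qm hsm.2.
split => //; first by rewrite qm.
rewrite qm; apply: has_mean_le hsm h _ => w; exact: (hm _).2.
Qed.

(** With [z t] integrated out, [gap_step_mean] holds at every state; integrating it gives both
    finiteness of the next mean and the recursion. *)
Let mean_a_step t : (1 <= t <= T)%N -> has_mean P (af t) (mean P (af t)) ->
  has_mean P (ef t) (mean P (ef t)) -> has_mean P (Gf t) (mean P (Gf t)) ->
  has_mean P (fun w => second_moment (xb t w)) (mean P (qf t)) ->
  has_mean P (af t.+1) (mean P (af t.+1)) /\
  mean P (af t.+1) <= mean P (af t) - 3 / 4 * eta * mean P (Gf t) +
    eta * L ^+ 2 * mean P (ef t) + L / 2 * eta ^+ 2 * mean P (qf t).
Proof.
move=> ht ha he hG hq.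
have ht1 : (1 <= t.+1 <= T.+1)%N by case/andP: ht.
have h := has_meanD _ _ _ _ _ (has_meanD _ _ _ _ _ (has_meanD _ _ _ _ _ ha
  (has_meanZ _ (- (3 / 4 * eta)) _ _ hG))
  (has_meanZ _ (eta * L ^+ 2) _ _ he))
  (has_meanZ _ (L / 2 * eta ^+ 2) _ _ hq).
rewrite -(mulNr _ (mean P (Gf t))); apply: ge0_has_mean.
- exact: (measurableT_comp measurable_gap (measurable_x t.+1 ht1)).
- by move=> w; exact: gap_ge0.
have mh : measurable_fun [set: (S * Z)%type] (fun p => (gap (F t p).1)%:E).
  apply/measurable_EFinP; apply: (measurableT_comp measurable_gap).
  exact: (measurableT_comp (@measurable_fst _ _ borel borel) (measurable_F t)).
have h0 (p : S * Z) : (0 <= (gap (F t p).1)%:E)%E by rewrite lee_fin gap_ge0.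
have -> : (\int[P]_w (af t.+1 w)%:E =
    \int[P]_w (gap (F t (X t w, z t w)).1)%:E)%E.
  by apply: eq_integral => w _; rewrite -XS.
rewrite (integral_fresh_sample z_iid X1 XS (fun s _ => measurable_F s) t
    (fun p => (gap (F t p).1)%:E))// -h.2.
apply: ge0_le_integral => //.
- by move=> w _; apply: integral_ge0.
- apply: (measurableT_comp (measurable_fun_fubini_tonelli_F _ mh h0)).
  exact/measurable_X/widenT.
- exact: measurable_int h.1.
- move=> w _.
  have := gap_step_mean L_gt0 f_smooth f_bounded_below g_oracle g_unbiased
    g_variance eta (x t w) (xb t w) eta_gt0.
  rewrite /F /oracle /= -xb_query// theta_eta// scale1r.
  under eq_integral do rewrite -scaleNr.
  by move=> /le_trans; apply; rewrite lee_fin /af /Gf /ef /second_moment mulNr.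
Qed.

Let mean_p_step t : (1 <= t <= T)%N -> has_mean P (pf t) (mean P (pf t)) ->
  has_mean P (ef t) (mean P (ef t)) -> has_mean P (qf t) (mean P (qf t)) ->
  has_mean P (pf t.+1) (mean P (pf t.+1)) /\
  mean P (pf t.+1) + mean P (ef t) <=
    mean P (pf t) + 2 * eta ^+ 2 * mean P (qf t).
Proof.
move=> ht hp he hq.
have ht1 : (1 <= t.+1 <= T.+1)%N by case/andP: ht.
have h := has_meanD _ _ _ _ _ hp (has_meanZ _ (2 * eta ^+ 2) _ _ hq).
have hp1 : has_mean P (pf t.+1) (mean P (pf t.+1)).
  apply: has_mean_dom h => [|w].
    apply: measurable_funM => //.
    by apply: measurable_sqnB; [exact: measurable_x|exact: measurable_xt].
  rewrite mulr_ge0 ?sqn_ge0//=; apply: le_trans (potential_step t w ht).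
  by rewrite lerDl sqn_ge0.
split => //; apply: has_mean_le (has_meanD _ _ _ _ _ hp1 he) h _ => w.
exact: potential_step.
Qed.

(** Integrability propagates around a cycle: [pf] controls [ef], then [af] and [ef] control [bf],
    from which [Gf] and [qf] follow, and these yield [af] and [pf] at the next time. *)
Let mean_ap t : (t <= T)%N ->
  has_mean P (af t.+1) (mean P (af t.+1)) /\
  has_mean P (pf t.+1) (mean P (pf t.+1)).
Proof.
elim: t => [_|t ih tT].
  have h1 : has_mean P (af 1) (gap x1).
    apply: eq_has_mean (has_mean_cst P (gap x1)) => w.
    by rewrite /af -[x 1%N w]/(X 1%N w).1 X1.
  have h2 : has_mean P (pf 1) 0.
    apply: eq_has_mean (has_mean_cst P 0) => w; rewrite /pf.
    rewrite -[x 1%N w]/(X 1%N w).1 -[xt 1%N w]/(X 1%N w).2 X1 /=.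
    by rewrite subrr sqn0 mulr0.
  by rewrite (has_meanE _ _ _ h1) (has_meanE _ _ _ h2).
have ht : (1 <= t.+1 <= T)%N by [].
have [ha hp] := ih (ltnW tT).
have he := mean_e t.+1 ht hp.
have [hb _] := mean_b t.+1 ht ha he.
have hG := mean_G t.+1 ht hb.
have [hq hsm _] := mean_q t.+1 ht hb hG.
by split; [have [] := mean_a_step t.+1 ht ha he hG hsm
          |have [] := mean_p_step t.+1 ht hp he hq].
Qed.

Let mean_all t : (1 <= t <= T)%N ->
  [/\ has_mean P (af t) (mean P (af t)), has_mean P (bf t) (mean P (bf t)),
      has_mean P (ef t) (mean P (ef t)), has_mean P (Gf t) (mean P (Gf t)) &
      has_mean P (pf t) (mean P (pf t))] /\
  [/\ has_mean P (qf t) (mean P (qf t)) &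
      has_mean P (fun w => second_moment (xb t w)) (mean P (qf t))].
Proof.
case: t => // t ht; have [ha hp] := mean_ap t (ltnW ht).
have he := mean_e t.+1 ht hp.
have [hb _] := mean_b t.+1 ht ha he.
have hG := mean_G t.+1 ht hb.
by have [hq hsm _] := mean_q t.+1 ht hb hG.
Qed.

Let mean_e_sum n : (n <= T)%N ->
  \sum_(1 <= t < n.+1) mean P (ef t) <=
  2 * eta ^+ 2 * \sum_(1 <= t < n.+1) mean P (qf t).
Proof.
(* Adding the final potential makes the inequality telescope; the initial potential is zero because
   both sequences start at [x1]. *)
move=> nT; apply: (@le_trans _ _
    (\sum_(1 <= t < n.+1) mean P (ef t) + mean P (pf n.+1))).
  by rewrite lerDl mean_ge0// => w; rewrite mulr_ge0// sqn_ge0.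
elim: n nT => [_|n ih nT].
  rewrite !big_geq// mulr0 add0r /mean.
  rewrite (_ : (fun w => (pf 1 w)%:E) = cst 0%E) ?integral0//.
  apply/funext => w; rewrite /pf.
  rewrite -[x 1%N w]/(X 1%N w).1 -[xt 1%N w]/(X 1%N w).2 X1 /=.
  by rewrite subrr sqn0 mulr0.
have [[_ _ he _ hp] [hq _]] := mean_all n.+1 nT.
have [_] := mean_p_step n.+1 nT hp he hq.
rewrite [X in _ -> X + _ <= _]big_nat_recr//=.
rewrite [X in _ -> _ <= _ * X]big_nat_recr//=.
by have := ih (ltnW nT); lra.
Qed.

Hypothesis etaB : L * (B + 1) * eta <= 1 / 4.
Hypothesis etaAT : L * A * eta ^+ 2 * T%:R <= 1 / 3.
Hypothesis etaA : L * A * eta ^+ 2 <= 1 / 20.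
Hypothesis etaCT : L * C * eta ^+ 2 * T%:R <= 2 / 3.

(** Naming the sum of expected squared gradient norms as a real [S] separates the probabilistic part
    from the step size computation. *)
Lemma mean_gradient_bound : exists2 S : R,
  eta / 2 * S <= f x1 - inf_value f +
    L * A * eta ^+ 2 * (2 * T%:R * (4 * (f x1 - inf_value f) + 8)) +
    L * C * eta ^+ 2 * T%:R &
  ('E_P[(fun w => T%:R^-1 *
      \sum_(1 <= t < T.+1) enorm (gradient f (xb t w)) ^+ 2)%R] =
    (T%:R^-1 * S)%:E)%E.
Proof.
exists (\sum_(1 <= t < T.+1) mean P (Gf t)); last first.
  have h : has_mean P (fun w => T%:R^-1 * \sum_(1 <= t < T.+1) Gf t w)
      (T%:R^-1 * \sum_(1 <= t < T.+1) mean P (Gf t)).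
    apply: has_meanZ; apply: has_mean_sum => t; rewrite mem_index_iota => ht.
    by have [[_ _ _ ?]] := mean_all t ht.
  rewrite unlock -h.2; apply: eq_integral => w _; congr (_ * _)%:E.
  by apply: eq_bigr => t _; rewrite enorm_sq.
have -> : f x1 - inf_value f = mean P (af 1).
  apply/esym/has_meanE; apply: eq_has_mean (has_mean_cst P _) => w.
  by rewrite /af -[x 1%N w]/(X 1%N w).1 X1.
apply: (@recursion_bound R T (fun t => mean P (af t)) (fun t => mean P (bf t))
  (fun t => mean P (ef t)) (fun t => mean P (Gf t)) (fun t => mean P (qf t))
  L A B C eta) => //.
- by move=> t; apply: mean_ge0 => w; exact: gap_ge0.
- by move=> t; apply: mean_ge0 => w; exact: gap_ge0.
- by move=> t; apply: mean_ge0 => w; exact: sqn_ge0.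
- by move=> t; apply: mean_ge0 => w; exact: sqn_ge0.
- move=> t ht; have [[ha _ he hG _] [_ hsm]] := mean_all t ht.
  by have [] := mean_a_step t ht ha he hG hsm.
- move=> t ht; have [[_ hb _ hG _] _] := mean_all t ht.
  by have [] := mean_q t ht hb hG.
- move=> t ht; have [[ha _ he _ _] _] := mean_all t ht.
  by have [] := mean_b t ht ha he.
Qed.

End run.

(** * The drift potential *)

Section potential.
Context {R : realType} {Z : Type} {d T : nat} {eta : R} {x1 : 'rV[R]_d}
  {alpha theta gamma : nat -> R} {g : 'rV[R]_d -> Z -> 'rV[R]_d}
  {z : nat -> Z} {x xt xb : nat -> 'rV[R]_d}.
Hypothesis run : agd_run T x1 alpha theta gamma g z x xt xb.

Lemma query_gap t : (1 <= t <= T)%N ->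
  x t - xb t = (1 - alpha t) *: (x t - xt t).
Proof.
move=> ht; have [_ _ /(_ t ht)[-> _ _]] := run.
by rewrite scalerBr !scalerBl !scale1r opprD addrA.
Qed.

Lemma iterate_gap t : (1 <= t <= T)%N ->
  x t.+1 - xt t.+1 =
  (1 - alpha t) *: (x t - xt t) + (gamma t - theta t) *: g (xb t) (z t).
Proof.
move=> ht; have [_ _ /(_ t ht)[_ -> ->]] := run.
rewrite -query_gap// scalerBl opprB addrACA [RHS]addrACA.
by congr (_ + _); rewrite addrC.
Qed.

(** With equal step sizes [iterate_gap] only rescales the difference, which starts at zero. *)
Lemma sgd_coincide t : sgd_parameters T eta alpha theta gamma ->
  (1 <= t <= T.+1)%N -> x t = xt t.
Proof.
move=> par; elim: t => // -[_ _|t ih ht]; first by have [-> ->] := run.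
apply/eqP; rewrite -subr_eq0 iterate_gap// ih; last exact: ltnW.
have [_ -> ->] := par t.+1 ht.
by rewrite !subrr scaler0 scale0r addr0.
Qed.

Lemma sgd_potential t : sgd_parameters T eta alpha theta gamma ->
  (1 <= t <= T)%N ->
  sqn (x t - xb t) <= t%:R * sqn (x t - xt t) /\
  t.+1%:R * sqn (x t.+1 - xt t.+1) + sqn (x t - xb t) <=
    t%:R * sqn (x t - xt t) + 2 * eta ^+ 2 * sqn (g (xb t) (z t)).
Proof.
move=> par ht; have ht1 : (1 <= t.+1 <= T.+1)%N by case/andP: ht.
have ht2 : (1 <= t <= T.+1)%N by move: ht => /andP[-> /leqW].
rewrite (sgd_coincide t.+1 par ht1) query_gap// (sgd_coincide t par ht2).
rewrite !subrr scaler0 !sqn0 !mulr0 !add0r; split => //.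
by rewrite mulr_ge0 ?sqn_ge0// mulr_ge0 ?sqr_ge0.
Qed.

(* The weight [t] works because [(t + 1) (1 - alpha t) = t - 1] and
   [(t + 1) alpha t = 2]. *)
Lemma rsag_potential t : rsag_parameters T eta alpha theta gamma ->
  (1 <= t <= T)%N ->
  sqn (x t - xb t) <= t%:R * sqn (x t - xt t) /\
  t.+1%:R * sqn (x t.+1 - xt t.+1) + sqn (x t - xb t) <=
    t%:R * sqn (x t - xt t) + 2 * eta ^+ 2 * sqn (g (xb t) (z t)).
Proof.
move=> par ht; have [ha -> hg] := par t ht.
have t1 : 1 <= t%:R :> R by rewrite ler1n; case/andP: ht.
have t10 : 0 < t%:R + 1 :> R by lra.
have a01 : 0 <= alpha t <= 1.
  by rewrite ha divr_ge0 ?ler_pdivrMr//; lra.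
have [a0 a1] := andP a01.
set u := x t - xt t; set gt := g (xb t) (z t).
have s0 := sqn_ge0 u.
have e1 : sqn (x t - xb t) <= sqn u.
  rewrite query_gap// sqnZ ler_piMl// expr_le1//; lra.
split; first by apply: le_trans e1 _; rewrite ler_peMl.
rewrite iterate_gap// -/u -/gt hg; have [_ -> _] := par t ht.
(* The new difference is thus a convex combination of [u] and [eta *: gt]. The weight of [sqn u]
   drops from [t] to [t - 1], and the freed unit pays for the drift by [e1]. *)
have -> : (1 + alpha t) * eta - eta = alpha t * eta by ring.
rewrite -scalerA -natr1.
have := sqn_convex _ u (eta *: gt) a01; rewrite sqnZ.
move=> h; have := ler_wpM2l (ltW t10) h.
have -> : (t%:R + 1) *
      ((1 - alpha t) * sqn u + alpha t * (eta ^+ 2 * sqn gt)) =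
    (t%:R - 1) * sqn u + 2 * (eta ^+ 2 * sqn gt).
  by rewrite ha; field; rewrite gt_eqF.
by lra.
Qed.

End potential.

Theorem theorem7 (R : realType)
  (dO dZ : measure_display)
  (Omega : measurableType dO) (P : probability Omega R)
  (Z : measurableType dZ) (D : probability Z R)
  (d T : nat)
  (f : 'rV[R]_d -> R) (fz : 'rV[R]_d -> Z -> R)
  (g : 'rV[R]_d -> Z -> 'rV[R]_d)
  (z : nat -> {RV P >-> Z})
  (L A B C : R) (x1 : 'rV[R]_d)
  (alpha theta gamma : nat -> R)
  (x xt xb : nat -> Omega -> 'rV[R]_d)
  (T_ge1 : (1 <= T)%N)
  (L_gt0 : 0 < L) (A_gt0 : 0 < A) (B_gt0 : 0 < B) (C_gt0 : 0 < C)
  (f_def : is_expected_objective D fz f)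
  (g_oracle : is_gradient_oracle fz g)
  (z_iid : iid_samples D T z)
  (f_smooth : smooth L f)
  (f_bounded_below : bounded_below f)
  (g_unbiased : unbiased D g f)
  (g_variance : relaxed_affine_variance D A B C g f)
  (run : forall w : Omega,
     agd_run T x1 alpha theta gamma g (fun t => z t w)
       (fun t => x t w) (fun t => xt t w) (fun t => xb t w)) :
  let Delta1 : R := f x1 - inf_value f in
  let Deltae : R := 4 * Delta1 + 8 in
  let K : R := A * Deltae + 2 * L * (B + 1) * Deltae + C in
  let eta : R :=
    Num.min (Num.min (Num.min
      (1 / Num.sqrt (3 * L * A * T%:R))
      (Num.sqrt (2 / (3 * L * C * T%:R))))
      (Num.sqrt (2 / (5 * L * K))))
      (1 / (4 * L * (B + 1))) in
  sgd_parameters T eta alpha theta gamma \/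
  rsag_parameters T eta alpha theta gamma ->
  ('E_P[(fun w => T%:R^-1 *
           \sum_(1 <= t < T.+1) enorm (gradient f (xb t w)) ^+ 2)%R] <=
   (2 * Delta1 / Num.sqrt T%:R
      * (Num.sqrt (3 * L * A) + Num.sqrt (3 * L * C / 2))
    + 4 / Num.sqrt (3 * T%:R)
      * (Deltae * Num.sqrt (L * A) + Num.sqrt (2 * L * C))
    + 2 * Delta1 / T%:R
      * (Num.sqrt (5 * L * K / 2) + 4 * L * (B + 1)))%R%:E)%E.

Proof.
move=> Delta1 Deltae K eta par.
have D0 : 0 <= Delta1 by rewrite subr_ge0 inf_value_le.
have eta_gt0 : 0 < eta by exact: stepsize_gt0.
have theta_eta t : (1 <= t <= T)%N -> theta t = eta.
  by move=> ht; case: par => /(_ t ht)[].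
(* The two methods enter the remaining argument only through these inequalities and [theta_eta]. *)
have pot w t : (1 <= t <= T)%N ->
  sqn (x t w - xb t w) <= t%:R * sqn (x t w - xt t w) /\
  t.+1%:R * sqn (x t.+1 w - xt t.+1 w) + sqn (x t w - xb t w) <=
    t%:R * sqn (x t w - xt t w) + 2 * eta ^+ 2 * sqn (g (xb t w) (z t w)).
  case: par => par; first exact: (sgd_potential (run w) t par).
  exact: (rsag_potential (run w) t par).
have etaB : L * (B + 1) * eta <= 1 / 4 by exact: stepsize_B.
have etaAT : L * A * eta ^+ 2 * T%:R <= 1 / 3 by exact: stepsize_AT.
have etaA : L * A * eta ^+ 2 <= 1 / 20 by exact: stepsize_A.
have etaCT : L * C * eta ^+ 2 * T%:R <= 2 / 3 by exact: stepsize_CT.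
have [S hS ->] := mean_gradient_bound T_ge1 L_gt0 A_gt0 B_gt0 C_gt0 eta_gt0
  g_oracle z_iid f_smooth f_bounded_below g_unbiased g_variance run theta_eta
  (fun t w ht => (pot w t ht).2) (fun t w ht => (pot w t ht).1)
  etaB etaAT etaA etaCT.
by rewrite lee_fin; exact: stepsize_conclusion.
Qed.
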